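(* Let $P$ be a non-split link projection on $S^2$ and let $n\ge 4$ be an integer. Then $P$ is the standard projection of a twist knot with $n$ crossings if and only if, for a suitable assignment of pairwise distinct letters to the regions of $P$, the axis system $s(P)$ is the following collection of axis words (words are taken up to cyclic permutation $\sigma$ and reversing $\varphi$, and are listed with multiplicity, one for each axis). (i) If $n=2m$ with $m\in\{2,3,4,\dots\}$: $$\begin{aligned} s(P)=\{\, & -C_0 R_0 R_1 R_2 \cdots R_{m-3} R_{m-2} C_1 L_{m-2} L_{m-3} \cdots L_2 L_1 L_0,\\ & C_0 I C_1 O,\ -L_0 R_0 I O R_0 L_0 O I,\\ & -R_1 I O,\ -R_2 I O,\ \dots,\ -R_{m-2} I O,\\ & -L_1 I O,\ -L_2 I O,\ \dots,\ -L_{m-2} I O \,\}. \end{aligned}$$ (ii) If $n=2m+1$ with $m\in\{2,3,4,\dots\}$: $$\begin{aligned} s(P)=\{\, & -C_0 R_0 R_1 R_2 \cdots R_{m-2} R_{m-1} L_{m-1} L_{m-2} \cdots L_2 L_1 L_0,\\ & C_0 I O,\ -L_0 R_0 I L_{m-1} O R_0 L_0 O R_{m-1} I,\ IO,\ IO,\ \dots,\ IO,\\ & -L_1 I R_{m-2} O,\ -L_2 I R_{m-3} O,\ -L_3 I R_{m-4} O,\ \dots,\ -L_{m-2} I R_1 O \,\}, \end{aligned}$$ where the word $IO$ occurs exactly $m-1$ times. Here the indices of the $R$'s increase by one from $0$ and the indices of the $L$'s decrease by one to $0$ in the first word of each list, and for $m=2$ the families indexed by $1,\dots,m-2$ are 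empty.
   Context: A link projection is the image on $S^2$ of a link in $S^3$ under a projection whose only singularities are finitely many transverse double points, called crossings. Link projections are assumed non-split (connected) and are considered up to ambient isotopy of $S^2$ and reflection. An edge is a segment of the projection between crossings with no crossing in its interior. A region is a connected component of the complement of the projection in $S^2$. A region is an $n$-gon if its boundary has $n$ edges (counted with multiplicity along the boundary walk). It is odd-sided or even-sided according to the parity of $n$. The boundary walk of a $k$-gon alternately meets $k$ corners (each at a crossing) and $k$ edges. These $2k$ items are cyclically ordered, and the item $k$ places further on is called opposite. Axes. Start at an edge, about to cross it transversely, or at a crossing, about to pass through it from a corner to the opposite corner at that crossing. Draw a curve by the following rules. On entering a region at an edge or corner, traverse the region and leave at the opposite item of its boundary (so in a $2n$-gon one goes from edge to opposite edge or from crossing to opposite crossing, and in a $(2n-1)$-gon from an edge to the opposite crossing or from a crossing to the opposite edge). On reaching an edge, cross it transversely into the region on its other side. On reaching a crossing, pass straight through it into the region at the opposite corner of that crossing. Each edge may be crossed at most once, and each crossing may be passed at most once in each of its two transverse directions (pairs of opposite corners). Continue until one returns to the starting point with the same direction. The resulting closed curve, regarded without start point or orientation, is an axis. Axis words and axis system. Give pairwise distinct letters to the regions. An axis word of an axis is the signed sequence of letters of the regions met when travelling once around the axis from some starting point (an edge or crossing on the axis) in some orientation. The sign is $-$ if one starts at an edge, and $+$ (omitted) if one starts at a crossing. A letter is an odd-letter (even-letter) if its region is odd-sided (even-sided). Equivalently, the parity is that of the number of times the letter occurs in all axis words, one word per axis. For $\varepsilon\in\{+,-\}$, the cyclic permutation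 is $\sigma(\varepsilon A B_1\cdots B_l)=\varepsilon B_1\cdots B_l A$ if $A$ is an even-letter, and $=-\varepsilon B_1\cdots B_l A$ if $A$ is an odd-letter. The reversing is $\varphi(\varepsilon A_1A_2\cdots A_l)=\varepsilon A_l\cdots A_2A_1$. The axis system $s(P)$ is the collection (with multiplicity) of axis words of all axes of $P$, one per axis, up to $\sigma$ and $\varphi$. Standard projection of a twist knot with $n\ge4$ crossings. This is the projection of the usual diagram consisting of a 2-crossing clasp and a row of $n-2$ half-twists (the usual diagrams of $4_1,5_2,6_1,7_2,8_1,\dots$). Explicitly, with $k=n-2$, the crossings are $a,b,t_1,\dots,t_k$. There are two edges between $a$ and $b$ bounding a 2-gon, and two edges between $t_i$ and $t_{i+1}$ bounding a 2-gon for each $1\le i\le k-1$. There are single edges $t_1a,\ t_1b,\ t_ka,\ t_kb$. The remaining regions are the 3-gon bounded by $t_1a$, $t_1b$ and one of the edges $ab$; the 3-gon bounded by $t_ka$, $t_kb$ and the other edge $ab$; the $(n-1)$-gon bounded by $t_1a$, $at_k$ and one of the two edges $t_it_{i+1}$ for each $i$; and the $(n-1)$-gon bounded by $t_1b$, $bt_k$ and the other edges $t_it_{i+1}$. *)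

(* Defs.v *)
From HB Require Import structures.
From mathcomp Require Import all_boot.
From Stdlib Require List Relation_Operators.

Set Implicit Arguments.
Unset Strict Implicit.
Unset Printing Implicit Defensive.

(* A four-valent graph embedded in an oriented surface, as a combinatorial map.
   A dart is an end of an edge at a crossing; [edge d] is the other end of the
   same edge, and [node d] is the next dart counterclockwise around the same
   crossing. *)
Record fourvalent_map := FourvalentMap {
  dart :> finType;
  edge : dart -> dart;
  node : dart -> dart;
  edgeK : involutive edge;
  edge_neq : forall d, edge d != d;
  node_inj : injective node;
  node4 : forall d, order node d = 4
}.

(* Leaving along [d] with the region on the left, the boundary walk of that
   region continues along the dart just clockwise of [edge d].  The orbits of
   [face] are the regions, and [d] and [d'] have the same region on their left
   iff [fconnect face d d']. *)
Definition face (P : fourvalent_map) (d : P) : P := finv (@node P) (edge d).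

(* The number of edges along the boundary walk, with multiplicity. *)
Definition nsides (P : fourvalent_map) (d : P) : nat := order (@face P) d.

(* Connected, and embedded in the sphere (Euler characteristic 2).  The empty
   map is allowed and stands for the circle without crossings, the only
   connected projection that has no dart; it has no axis. *)
Definition nonsplit_projection (P : fourvalent_map) : Prop :=
  (forall d d' : P, connect (fun x y => (y == edge x) || (y == node x)) d d')
  /\ (0 < #|P| ->
      fcard (@node P) predT + fcard (@face P) predT
      = fcard (@edge P) predT + 2).

(* Equality up to ambient isotopy of the sphere and reflection; a reflection
   exchanges the two senses of rotation around each crossing. *)
Definition same_projection (P Q : fourvalent_map) : Prop :=
  exists h : P -> Q,
    [/\ bijective h,
        forall d, h (edge d) = edge (h d)
      & (forall d, h (node d) = node (h d)) \/
        (forall d, h (node d) = finv (@node Q) (h d))].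

Section Axes.

Variable P : fourvalent_map.

(* The item [(d, true)] is the edge of [d] seen from the region on the left of
   [d]; the item [(d, false)] is the corner of that region between [d] and
   [node d].  Every item belongs to the boundary walk of exactly one region.
   As a state of a moving point, an item is read as being about to enter this
   region there. *)
Definition item : finType := (P * bool)%type.

Definition next_item (x : item) : item :=
  if x.2 then (face x.1, false) else (x.1, true).

Definition opposite (x : item) : item := iter (nsides x.1) next_item x.

Definition across (x : item) : item :=
  if x.2 then (edge x.1, true) else (node (node x.1), false).

Definition step (x : item) : item := across (opposite x).

(* [across x] is the state [x] with its direction reversed, so the two orbits
   below are the two orientations of the closed curve through [x].  Both
   [opposite] and [across] are fixed-point free involutions, hence the two
   orbits are disjoint and no edge, and no direction through a crossing, is
   used twice. *)
Definition axis (x : item) : {set item} :=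
  [set y | fconnect step x y || fconnect step (across x) y].

Definition axes : {set {set item}} := [set axis x | x : item].

End Axes.

(* A signed word; the boolean is [true] for the sign - and [false] for +. *)
Definition word (T : Type) : Type := (bool * seq T)%type.

Definition sigma (T : Type) (oddl : pred T) (w : word T) : word T :=
  if w.2 is A :: B then (oddl A (+) w.1, rcons B A) else w.

Definition reversing (T : Type) (w : word T) : word T := (w.1, rev w.2).

Definition word_equiv (T : Type) (oddl : pred T) : word T -> word T -> Prop :=
  Relation_Operators.clos_refl_sym_trans (word T)
    (fun u v => v = sigma oddl u \/ v = reversing u).

Section AxisSystem.

Variables (P : fourvalent_map) (T : eqType) (lab : P -> T).

(* [lab d] is the letter of the region on the left of [d]. *)
Definition region_lettering : Prop :=
  forall d d' : P, lab d = lab d' <-> fconnect (@face P) d d'.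

Definition odd_letter : pred T :=
  fun A => [exists d : P, (lab d == A) && odd (nsides d)].

Definition axis_word (x : item P) : word T :=
  (x.2, [seq lab y.1 | y <- orbit (@step P) x]).

(* [starts] picks one starting point and orientation on each axis. *)
Definition axis_system_is (s : seq (word T)) : Prop :=
  exists2 starts : seq (item P),
    perm_eq [seq axis x | x <- starts] (enum (axes P))
    & List.Forall2 (word_equiv odd_letter) [seq axis_word x | x <- starts] s.

End AxisSystem.

(* The crossings of the twist knot projection are drawn as follows: the row
   [t_1 ... t_k] is horizontal, [a] is above it and [b] below it.
   [inl true] is [a], [inl false] is [b] and [inr i] is [t_(i+1)]; the
   index type forces [k = n - 2] for [3 <= n]. *)
Definition twist_crossing (n : nat) : finType := (bool + 'I_(n - 3).+1)%type.

(* [(c, (v, h))] is the dart at [c] pointing north iff [v] and east iff [h]. *)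
Definition twist_dart (n : nat) : finType :=
  (twist_crossing n * (bool * bool))%type.

Definition twist_node n (d : twist_dart n) : twist_dart n :=
  let: (c, (v, h)) := d in (c, (h, ~~ v)).

Definition twist_edge n (d : twist_dart n) : twist_dart n :=
  match d with
  | (inl u, (v, h)) =>
      if u == v then (inl (~~ u), (~~ v, h))
      else (inr (if h then ord_max else ord0), (u, h))
  | (inr i, (v, true)) =>
      if i == ord_max then (inl v, (~~ v, true))
      else (inr (inord i.+1), (v, false))
  | (inr i, (v, false)) =>
      if i == ord0 then (inl v, (~~ v, false))
      else (inr (inord i.-1), (v, true))
  end.

Lemma twist_edgeK n : involutive (@twist_edge n).
Proof.
case=> [[u|i] [v h]] /=.
  by case: u v h => [] [] [] //=; rewrite eqxx.
case: h.
  have [->|ni] := eqVneq i ord_max; first by case: v.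
  have lti : i.+1 < (n - 3).+1.
    by rewrite ltn_neqAle (ltn_ord i) eqSS andbT; apply: contraNneq ni => e; apply/eqP/val_inj.
  rewrite /= -val_eqE /= inordK //=.
  by congr (inr _, _); apply: val_inj; rewrite /= inordK.
have [->|ni] := eqVneq i ord0; first by case: v.
have i0 : 0 < i by rewrite lt0n; apply: contraNneq ni => e; apply/eqP/val_inj.
have ei : i.-1.+1 = i by rewrite prednK.
have lei : i.-1 < (n - 3).+1 by rewrite (leq_trans _ (ltn_ord i)) // ei ltnW.
rewrite /= -val_eqE /= inordK //= ltn_eqF; last by rewrite -ltnS ei.
by congr (inr _, _); apply: val_inj; rewrite /= ei inordK.
Qed.

Lemma twist_edge_neq n (d : twist_dart n) : twist_edge d != d.
Proof.
case: d => [[u|i] [v h]] /=; first by case: u v h => [] [] [].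
by case: h; case: ifP => _; apply/eqP => -[].
Qed.

Lemma twist_node_inj n : injective (@twist_node n).
Proof. by move=> [c [v h]] [c' [v' h']] [-> -> /negb_inj ->]. Qed.

Lemma twist_node4 n (d : twist_dart n) : order (@twist_node n) d = 4.
Proof.
rewrite (@order_cycle _ _ (traject (@twist_node n) d 4)) ?mem_head //.
  by case: d => c [[] []] /=; rewrite !eqxx.
by case: d => c [[] []] /=; rewrite !inE !xpair_eqE !eqxx.
Qed.

Definition twist_map (n : nat) : fourvalent_map :=
  FourvalentMap (@twist_edgeK n) (@twist_edge_neq n)
                (@twist_node_inj n) (@twist_node4 n).

Inductive letter := C of nat | R of nat | L of nat | I | O.

Definition letter_code (x : letter) : nat * nat :=
  match x with
  | C i => (0, i) | R i => (1, i) | L i => (2, i) | I => (3, 0) | O => (4, 0)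
  end.

Definition letter_decode (c : nat * nat) : letter :=
  match c with
  | (0, i) => C i | (1, i) => R i | (2, i) => L i | (3, _) => I | _ => O
  end.

Lemma letter_codeK : cancel letter_code letter_decode.
Proof. by case. Qed.

HB.instance Definition _ := Equality.copy letter (can_type letter_codeK).

Definition twist_words_even (m : nat) : seq (word letter) :=
  [:: (true, C 0 :: [seq R i | i <- iota 0 m.-1]
             ++ C 1 :: rev [seq L i | i <- iota 0 m.-1]);
      (false, [:: C 0; I; C 1; O]);
      (true, [:: L 0; R 0; I; O; R 0; L 0; O; I])]
  ++ [seq (true, [:: R i; I; O]) | i <- iota 1 (m - 2)]
  ++ [seq (true, [:: L i; I; O]) | i <- iota 1 (m - 2)].

Definition twist_words_odd (m : nat) : seq (word letter) :=
  [:: (true, C 0 :: [seq R i | i <- iota 0 m]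
             ++ rev [seq L i | i <- iota 0 m]);
      (false, [:: C 0; I; O]);
      (true, [:: L 0; R 0; I; L m.-1; O; R 0; L 0; O; R m.-1; I])]
  ++ nseq m.-1 (false, [:: I; O])
  ++ [seq (true, [:: L i; I; R (m.-1 - i); O]) | i <- iota 1 (m - 2)].

Definition twist_words (n : nat) : seq (word letter) :=
  if odd n then twist_words_odd n./2 else twist_words_even n./2.

(* Main.v *)
From HB Require Import structures.
Require Import Defs.
From mathcomp Require Import all_boot zify.
From Stdlib Require List Relation_Operators.

(** The axis words see the dual graph of the projection.  Along an axis the
    sign is - exactly when the next region is entered across an edge, and the
    sign changes at the odd letters, so two cyclically consecutive letters of
    an axis word are known to be the regions on both sides of an edge, or to
    be opposite at a crossing.  Each region is met as often as it has sides,
    hence the parities of the letters can be counted in the words themselves,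
    and the total length of the words is the number of darts.

    With N = n - 1, the dual graph of the twist projection is a _wheel_: two
    _hubs_ (the two N-gons, I and O), each adjacent to N _spokes_ (the bigons
    of the row and the two triangles), and the _clasp_ bigon, adjacent to the
    two triangles only.  A dart is determined by the regions on its left and
    on its right, and in these coordinates the boundary walks are explicit
    rotations ([wheel]; [twist_wheel] gives the coordinates of the twist
    projection).

    From left to right, a projection isomorphic to the twist projection is a
    wheel ([wheel_same]; a reflection is compensated by exchanging the two
    hubs).  In coordinates one step along an axis is an explicit map, so the
    axes can be listed; the list is complete because its curves pass every
    region as many times as needed ([wheel_axis_system]).

    From right to left, word equivalence only moves the starting point and the
    orientation, so the listed words are themselves axis words
    ([axis_system_starts]).  They exhibit every adjacency of the wheel
    ([twist_links]), and since the number of darts is also that of the wheel,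
    there are no others and no multiple ones.  It remains to see that this
    dual graph determines the rotations around the regions
    ([wheel_recognition]).  Around a spoke or the clasp there is hardly any
    choice.  Around a crossing the boundary walks close up after four corners;
    applied at the clasp this puts the two triangles side by side on both
    hubs, and applied along a hub it shows that the two hubs meet the spokes in
    opposite cyclic orders.  Numbering the spokes in the order of one hub
    gives the coordinates of a wheel, and two wheels with the same N are
    isomorphic ([wheel_unique]). *)

Set Implicit Arguments.
Unset Strict Implicit.
Unset Printing Implicit Defensive.

(** * Orbits *)

Lemma orbit_fcycle (T : finType) (f : T -> T) (x : T) (s : seq T) :
  fcycle f (x :: s) -> uniq (x :: s) -> orbit f x = x :: s.
Proof.
move=> cyc us; rewrite /orbit (order_cycle cyc us (mem_head _ _)).
by move: cyc; rewrite /= rcons_path => /andP[/fpathP[k ->]] _; rewrite size_traject.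
Qed.

Lemma inj_iter (T : Type) (f : T -> T) k : injective f -> injective (iter k f).
Proof. by move=> f_inj; elim: k => // k IHk x y /f_inj /IHk. Qed.

Lemma orbit_cons (T : finType) (f : T -> T) (x : T) :
  orbit f x = x :: behead (orbit f x).
Proof. by rewrite /orbit -orderSpred. Qed.

Lemma orbit_shift (T : finType) (f : T -> T) (x : T) :
  injective f -> orbit f (f x) = rcons (behead (orbit f x)) x.
Proof.
move=> f_inj; have e : order f (f x) = order f x.
  by apply: eq_card => y; rewrite !inE (same_connect (fconnect_sym f_inj) (fconnect1 f x)).
rewrite /orbit e; case E: (order f x) => [|k]; first by have := order_gt0 f x; rewrite E.
by rewrite trajectSr /= -iterSr -E iter_order.
Qed.

Lemma count_enum (T : finType) (a : pred T) : count a (enum T) = #|[pred x | a x]|.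
Proof. by rewrite enumT cardE /enum_mem size_filter. Qed.

(** * Items, opposites and axes *)

Section Items.

Variable P : fourvalent_map.
Implicit Types (d : P) (x y : item P).

Lemma face_inj : injective (@face P).
Proof. by move=> d d' /(finv_inj (@node_inj P)) /(inv_inj (@edgeK P)). Qed.

Lemma node_face d : node (face d) = edge d.
Proof. exact: f_finv (@node_inj P) _. Qed.

Lemma nsides_gt0 d : 0 < nsides d.
Proof. exact: order_gt0. Qed.

Lemma nsides_fconnect d d' : fconnect (@face P) d d' -> nsides d' = nsides d.
Proof.
move=> c; apply: eq_card => y; rewrite !inE.
by rewrite (same_connect (fconnect_sym face_inj) c).
Qed.

Lemma iter_next_item k x :
  iter k.*2 (@next_item P) x = (iter k (@face P) x.1, x.2).
Proof.
elim: k => [|k IHk]; first by case: x.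
by rewrite doubleS !iterS IHk; case: x.2.
Qed.

(** Two items further on is the same kind of item one dart further along the
    boundary walk, so [opposite] is half a turn of [face], rounded up or down
    according to the kind when the number of sides is odd. *)
Lemma oppositeE x : opposite x =
  let k := (nsides x.1)./2 in
  if odd (nsides x.1)
  then (if x.2 then (iter k.+1 (@face P) x.1, false) else (iter k (@face P) x.1, true))
  else (iter k (@face P) x.1, x.2).
Proof.
rewrite /opposite -{1}(odd_double_half (nsides x.1)).
case: odd; rewrite /= ?add1n ?add0n ?iterS iter_next_item //.
Qed.

Lemma opposite_face x : fconnect (@face P) x.1 (opposite x).1.
Proof.
by rewrite oppositeE /=; case: ifP => _; [case: ifP => _|]; rewrite ?fconnect_iter //= -iterS fconnect_iter.
Qed.

Lemma opposite_kind x : (opposite x).2 = odd (nsides x.1) (+) x.2.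
Proof. by rewrite oppositeE /=; case: odd => //; case: x.2. Qed.

Lemma oppositeK : involutive (@opposite P).
Proof.
move=> x; have e := nsides_fconnect (opposite_face x).
rewrite {1}/opposite e /opposite -iterD addnn iter_next_item.
by rewrite iter_order; [case: (x) | exact: face_inj].
Qed.

Lemma opposite_neq x : opposite x != x.
Proof.
apply/eqP => e; have := opposite_kind x; rewrite e.
case o: (odd _); first by case: x.2.
move=> _.
have := oppositeE x; rewrite e o /= => /(congr1 fst) /= e'.
have k0 : 0 < (nsides x.1)./2 by have := nsides_gt0 x.1; lia.
have kn : (nsides x.1)./2 < order (@face P) x.1 by rewrite -/(nsides x.1); lia.
by have := findex_iter kn; rewrite -e' findex0; lia.
Qed.

Lemma acrossK : involutive (@across P).
Proof.
case=> d [] /=; rewrite /across /= ?edgeK //.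
have -> : node (node (node (node d))) = iter (order (@node P) d) (@node P) d by rewrite node4.
by rewrite iter_order //; apply: node_inj.
Qed.

Lemma across_kind x : (across x).2 = x.2.
Proof. by rewrite /across; case E: x.2. Qed.

Lemma across_neq x : across x != x.
Proof.
case: x => d [] /=; apply/eqP => -[]; first by apply/eqP/edge_neq.
move=> e; have kn : 2 < order (@node P) d by rewrite node4.
by have := findex_iter kn; rewrite /= e findex0.
Qed.

Lemma step_inj : injective (@step P).
Proof. by move=> x y /(inv_inj acrossK) /(inv_inj oppositeK). Qed.

Lemma across_step x : across (step x) = opposite x.
Proof. exact: acrossK. Qed.

Lemma step_opposite x : step (opposite x) = across x.
Proof. by rewrite /step oppositeK. Qed.

Lemma step_kind x : (step x).2 = odd (nsides x.1) (+) x.2.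
Proof. by rewrite /step across_kind opposite_kind. Qed.

(** Reversing the direction of travel reads the same passes backwards, each one
    entered where it was left before. *)
Lemma orbit_across x :
  orbit (@step P) (across x) = rev [seq opposite y | y <- orbit (@step P) x].
Proof.
set o := orbit _ x.
have [y [s e]] : exists y s, o = rcons s y.
  have := orbit_cons (@step P) x; rewrite -/o.
  by case/lastP: (o) => // s y _; exists y, s.
have ey : step y = x.
  have := cycle_orbit step_inj x; rewrite -/o.
  have : o = x :: behead o by exact: orbit_cons.
  case: (o) e => // z s' e [ez]; rewrite ez in e *.
  rewrite /= rcons_path => /andP[_ /eqP es].
  by rewrite -[RHS]es -(last_cons x) e last_rcons.
have e' : rev [seq opposite z | z <- o] = across x :: rev [seq opposite z | z <- s].
  by rewrite e map_rcons rev_rcons -ey across_step.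
rewrite e'; apply: orbit_fcycle; rewrite -e'.
  rewrite rev_cycle cycle_map; have := cycle_orbit step_inj x; rewrite -/o.
  by apply: sub_cycle => z t /= /eqP <-; rewrite step_opposite across_step.
by rewrite rev_uniq (map_inj_uniq (inv_inj oppositeK)) orbit_uniq.
Qed.

Lemma fconnect_across x y :
  fconnect (@step P) (across x) y = fconnect (@step P) x (opposite y).
Proof.
rewrite !fconnect_orbit orbit_across mem_rev -{1}(oppositeK y).
by rewrite mem_map //; apply: inv_inj oppositeK.
Qed.

(** Hence every pass of an axis, recorded by one of the two items [y] and
    [opposite y], is counted once per orientation. *)
Lemma in_axis x y :
  (y \in axis x) = fconnect (@step P) x y || fconnect (@step P) x (opposite y).
Proof. by rewrite inE fconnect_across. Qed.

Lemma iter_step_opposite k x :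
  iter k (@step P) (opposite (iter k (@step P) x)) = opposite x.
Proof.
elim: k x => // k IHk x.
by rewrite iterSr iterS step_opposite {1}/step acrossK IHk.
Qed.

(** The two orientations of an axis are disjoint: [step] is the product of two
    fixed-point free involutions, and a point sent to its own opposite by a
    power of [step] would yield, halfway, a fixed point of one of them. *)
Lemma not_fconnect_opposite x : ~~ fconnect (@step P) x (opposite x).
Proof.
apply/negP => /iter_findex; set k := findex _ _ _ => e.
pose z := iter k./2 (@step P) x.
have e2 : iter k./2 (@step P) (opposite z) = iter k./2 (@step P) (iter (odd k) (@step P) z).
  by rewrite iter_step_opposite -e /z -!iterD; congr iter; lia.
have := inj_iter step_inj e2.
case: odd => /= ez; first by have := across_neq (opposite z); rewrite -[across _]ez eqxx.
by have := opposite_neq z; rewrite ez eqxx.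
Qed.

Lemma axis_disjoint x y :
  (fconnect (@step P) x y && fconnect (@step P) x (opposite y)) = false.
Proof.
apply/negP => /andP[xy xoy]; case/negP: (not_fconnect_opposite y).
by rewrite -(same_connect (fconnect_sym step_inj) xy).
Qed.

Lemma axis_fconnect x y : fconnect (@step P) x y -> axis x = axis y.
Proof.
by move=> xy; apply/setP => z; rewrite !in_axis !(same_connect (fconnect_sym step_inj) xy).
Qed.

Lemma axis_step x : axis (step x) = axis x.
Proof. by rewrite -(axis_fconnect (fconnect1 _ x)). Qed.

Lemma axis_across x : axis (across x) = axis x.
Proof. by apply/setP => z; rewrite !in_axis !fconnect_across oppositeK orbC. Qed.

Lemma mem_axis x : x \in axis x.
Proof. by rewrite in_axis connect0. Qed.

Lemma axis_eq x y : y \in axis x -> axis x = axis y.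
Proof.
rewrite in_axis => /orP[] /axis_fconnect -> //.
by rewrite -axis_step step_opposite axis_across.
Qed.

End Items.

(** * Axis words *)

(** All the letters of a list of words. *)
Definition text (T : Type) (ws : seq (word T)) : seq T := flatten [seq w.2 | w <- ws].

Section Words.

Variables (P : fourvalent_map) (T : eqType) (lab : P -> T).
Hypothesis lettering : region_lettering lab.
Implicit Types (x y : item P) (A : T).

Lemma lab_opposite x : lab (opposite x).1 = lab x.1.
Proof. by apply/esym/lettering; apply: opposite_face. Qed.

Lemma odd_letter_lab d : odd_letter lab (lab d) = odd (nsides d).
Proof.
apply/existsP/idP => [[d' /andP[/eqP/lettering/nsides_fconnect <-]] //|o].
by exists d; rewrite eqxx.
Qed.

Lemma sigma_axis_word x : sigma (odd_letter lab) (axis_word lab x) = axis_word lab (step x).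
Proof.
rewrite /axis_word orbit_shift; last exact: step_inj.
by rewrite {1}orbit_cons /= /sigma /= odd_letter_lab step_kind map_rcons.
Qed.

Lemma reversing_axis_word x : reversing (axis_word lab x) = axis_word lab (across x).
Proof.
rewrite /axis_word /reversing /= across_kind orbit_across map_rev -map_comp.
by congr (_, rev _); apply: eq_map => y /=; rewrite lab_opposite.
Qed.

Lemma sigma_inj (oddl : pred T) : injective (sigma oddl).
Proof.
move=> [b [|A s]] [b' [|A' s']] //=; rewrite /sigma /=.
- by case=> _ /(congr1 size); rewrite size_rcons.
- by case=> _ /(congr1 size); rewrite size_rcons.
by case=> e /rcons_inj[-> eA]; move: e; rewrite eA => /addbI ->.
Qed.

(** Both [sigma] and [reversing] act on the axis words of a given axis, by moving
    the starting point one region on and by reversing the orientation. *)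
Lemma axis_word_equiv (X : {set item P}) u v :
  word_equiv (odd_letter lab) u v ->
  (exists2 x, axis x = X & axis_word lab x = u) <->
  (exists2 x, axis x = X & axis_word lab x = v).
Proof.
elim=> {u v} [u v|//|u v _ [IH1 IH2]|u v w _ [IH1 IH2] _ [IH3 IH4]]; [|by split| by split; auto].
case=> ->; split => -[x <-].
- by move=> <-; exists (step x); rewrite ?axis_step ?sigma_axis_word.
- have [y ->] : exists y, x = step y.
    by exists (opposite (across x)); rewrite step_opposite acrossK.
  by rewrite -sigma_axis_word axis_step => /sigma_inj; exists y.
- by move=> <-; exists (across x); rewrite ?axis_across ?reversing_axis_word.
move=> e; exists (across x); first exact: axis_across.
by rewrite -reversing_axis_word e /reversing /= revK; case: (u).
Qed.

(** Up to the choice of starting points, the words of an axis system may be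
    taken literally. *)
Lemma axis_system_starts (s : seq (word T)) :
  axis_system_is lab s <->
  exists2 starts, perm_eq [seq axis x | x <- starts] (enum (axes P))
                & [seq axis_word lab x | x <- starts] = s.
Proof.
split=> [[starts pe]|[starts pe <-]]; last first.
  exists starts => //; elim: (starts) => [|x l IH] /=; constructor => //.
  exact: Relation_Operators.rst_refl.
move=> F; suff [l e <-] : exists2 l, [seq axis x | x <- starts] = [seq axis x | x <- l]
     & [seq axis_word lab x | x <- l] = s by exists l; rewrite -?e.
elim: starts s F {pe} => [|x l IH] [|w s] F; first by exists [::].
- by inversion F.
- by inversion F.
have [wx ws] : word_equiv (odd_letter lab) (axis_word lab x) w
  /\ List.Forall2 (word_equiv (odd_letter lab)) [seq axis_word lab x | x <- l] s by inversion F.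
have [l' el <-] := IH _ ws.
have [/(_ (ex_intro2 _ _ x erefl erefl)) [y ey <-] _] := axis_word_equiv (axis x) wx.
by exists (y :: l') => //=; rewrite ey el.
Qed.

(** ** Each letter occurs once per side of its region *)

Section Count.

Variable starts : seq (item P).
Hypothesis starts_axes : perm_eq [seq axis x | x <- starts] (enum (axes P)).

Let S := flatten [seq orbit (@step P) x | x <- starts].

(** The passes of the axes, together with their opposites, are all the items. *)
Let perm_items : perm_eq (S ++ [seq opposite y | y <- S]) (enum (item P)).
Proof.
apply/allP => z _; rewrite /= count_cat (count_uniq_mem _ (enum_uniq _)) mem_enum.
have co : preim (@opposite P) (pred1 z) =1 pred1 (opposite z).
  by move=> y /=; rewrite (can2_eq (@oppositeK P) (@oppositeK P)).
rewrite count_map (eq_count co) {co}.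
have count_S y : count_mem y S = \sum_(x <- starts) fconnect (@step P) x y.
  rewrite /S; elim: (starts) => [|x l IH]; first by rewrite big_nil.
  rewrite /= count_cat IH big_cons; congr addn.
  by rewrite count_uniq_mem ?orbit_uniq // -fconnect_orbit.
rewrite !count_S -big_split /= (eq_bigr (fun x => (z \in axis x) : nat)); last first.
  move=> x _; rewrite in_axis; have := axis_disjoint x z.
  by case: (fconnect _ x z) => //= ->.
rewrite -(big_map (@axis P) xpredT (fun X : {set item P} => (z \in X) : nat)) (perm_big _ starts_axes).
rewrite big_enum /= (bigD1 (axis z)) ?imset_f //= mem_axis big1 ?addn0 // => X /andP[].
case/imsetP => x _ ->; case zx: (z \in _) => //=.
by rewrite (axis_eq zx) eqxx.
Qed.

Let W := text [seq axis_word lab x | x <- starts].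

Let W_S : W = [seq lab y.1 | y <- S].
Proof. by rewrite /W /text /S map_flatten -!map_comp. Qed.

Lemma card_darts : #|P| = size W.
Proof.
have := perm_size perm_items; rewrite size_cat size_map -cardE card_prod card_bool W_S size_map.
by rewrite addnn -muln2 => /eqP; rewrite eqn_pmul2r // => /eqP.
Qed.

Lemma count_letter A : count_mem A W = #|[pred d | lab d == A]|.
Proof.
have /permP/(_ (fun y => lab y.1 == A)) := perm_items.
have co : preim (@opposite P) (fun y => lab y.1 == A) =1 (fun y => lab y.1 == A).
  by move=> y /=; rewrite lab_opposite.
rewrite count_cat count_map (eq_count co) {co} count_enum.
have -> : #|[pred y : item P | lab y.1 == A]| = #|[pred d | lab d == A]| * 2.
  by rewrite -card_bool -cardX; apply: eq_card => y; rewrite !inE andbT.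
by rewrite addnn -muln2 W_S count_map => /eqP; rewrite eqn_pmul2r // => /eqP.
Qed.

Lemma nsides_count d : nsides d = count_mem (lab d) W.
Proof.
rewrite count_letter; apply: eq_card => d'; rewrite !inE.
by rewrite eq_sym; apply/idP/eqP => /lettering.
Qed.

Lemma odd_letter_count A : odd_letter lab A = odd (count_mem A W).
Proof.
apply/existsP/idP => [[d /andP[/eqP <-]]|]; first by rewrite nsides_count.
move=> o; have : has (pred1 A) W by rewrite has_count; case: count o.
rewrite W_S has_map => /hasP[y _ /= /eqP e].
by exists y.1; rewrite e eqxx nsides_count e.
Qed.

End Count.

End Words.

(** * Wheels *)

(** The regions of a wheel.  [Hub true] and [Hub false] are the upper hub I and
    the lower hub O.  [Spoke 0] and [Spoke 1] are the triangles and the other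
    spokes, numbered by naturals below the number N of spokes, are bigons. *)
Inductive site := Clasp | Hub of bool | Spoke of nat.

Definition site_code (a : site) : option bool + nat :=
  match a with Clasp => inl None | Hub s => inl (Some s) | Spoke j => inr j end.

Definition site_decode (c : option bool + nat) : site :=
  match c with inl None => Clasp | inl (Some s) => Hub s | inr j => Spoke j end.

Lemma site_codeK : cancel site_code site_decode.
Proof. by case. Qed.

HB.instance Definition _ := Equality.copy site (can_type site_codeK).

(** [a] and [b] have a common edge in the wheel with [N] spokes. *)
Definition adjacent N (a b : site) : bool :=
  match a, b with
  | Clasp, Spoke j | Spoke j, Clasp => j < 2
  | Hub _, Spoke j | Spoke j, Hub _ => j < N
  | _, _ => false
  end.

(** Successor and predecessor modulo [N] on the naturals below [N]. *)
Definition up N j := if j.+1 == N then 0 else j.+1.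
Definition down N j := if j == 0 then N.-1 else j.-1.

(** Walking around the region [a] with [a] on the left, the neighbour that
    follows [b].  The upper hub meets the spokes in increasing cyclic order and
    the lower hub in decreasing order.  Pairs that are not adjacent get a junk
    value. *)
Definition turn N (a b : site) : site :=
  match a, b with
  | Clasp, Spoke j => Spoke (1 - j)
  | Hub true, Spoke j => Spoke (up N j)
  | Hub false, Spoke j => Spoke (down N j)
  | Spoke 0, Hub true => Hub false
  | Spoke 0, Hub false => Clasp
  | Spoke 0, Clasp => Hub true
  | Spoke 1, Hub true => Clasp
  | Spoke 1, Hub false => Hub true
  | Spoke 1, Clasp => Hub false
  | Spoke _, Hub s => Hub (~~ s)
  | _, _ => b
  end.

(** The reflection of the wheel that exchanges the two hubs. *)
Definition mirror (a : site) : site := if a is Hub s then Hub (~~ s) else a.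

(** The neighbour of [a] that precedes [b]: exchanging the two hubs reverses all
    the boundary walks. *)
Definition unturn N (a b : site) : site := mirror (turn N (mirror a) (mirror b)).

Lemma mirrorK : involutive mirror.
Proof. by case=> // s; rewrite /= negbK. Qed.

Lemma adjacent_mirror N a b : adjacent N (mirror a) (mirror b) = adjacent N a b.
Proof. by case: a => [|s|j]; case: b. Qed.

Lemma adjacentC N a b : adjacent N a b = adjacent N b a.
Proof. by case: a => [|s|j]; case: b. Qed.

Lemma turnK N a b : 1 < N -> adjacent N a b -> unturn N a (turn N a b) = b.
Proof.
rewrite /unturn => N1; case: a => [|[]|[|[|j]]]; case: b => [|[]|k] //= lk; congr Spoke;
  rewrite /up /down; try lia; by repeat case: eqP; lia.
Qed.

Definition swap (T : Type) (x : T * T) : T * T := (x.2, x.1).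

Lemma swapK (T : Type) : involutive (@swap T).
Proof. by case. Qed.

Definition spokes (a : site) k : seq (site * site) := [seq (a, Spoke j) | j <- iota 0 k].

(** The pairs of adjacent regions, each standing for a dart. *)
Definition arcs N : seq (site * site) :=
  let out := spokes Clasp 2 ++ spokes (Hub true) N ++ spokes (Hub false) N in
  out ++ [seq swap x | x <- out].

Lemma mem_spokes a k x :
  (x \in spokes a k) = if x.2 is Spoke j then (x.1 == a) && (j < k) else false.
Proof.
case: x => c [|s|j] /=; try by apply/mapP => -[].
apply/mapP/andP => [[i + [-> ->]]|[/eqP-> lk]]; first by rewrite mem_iota add0n eqxx.
by exists j => //; rewrite mem_iota.
Qed.

Lemma size_arcs N : size (arcs N) = 4 * N + 4.
Proof. by rewrite /arcs !size_cat !size_map !size_cat !size_map !size_iota; lia. Qed.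

Lemma mem_arcs N a b : ((a, b) \in arcs N) = adjacent N a b.
Proof.
rewrite /arcs !mem_cat -[(a, b) in X in _ || X]swapK (mem_map (inv_inj (@swapK _))).
rewrite !mem_cat !mem_spokes /swap /=.
by case: a b => [|[]|j] [|[]|k]; rewrite ?orbF.
Qed.

Lemma uniq_arcs N : uniq (arcs N).
Proof.
have uniq_spokes c k : uniq (spokes c k).
  by rewrite map_inj_uniq ?iota_uniq // => i j [].
rewrite /arcs cat_uniq (map_inj_uniq (inv_inj (@swapK _))) !cat_uniq !uniq_spokes !andTb.
have -> : ~~ has [in spokes Clasp 2] (spokes (Hub true) N ++ spokes (Hub false) N).
  apply/hasPn => -[a b]; rewrite mem_cat !mem_spokes /=.
  by case: a b => [|[]|j] [|[]|k].
have -> : ~~ has [in spokes (Hub true) N] (spokes (Hub false) N).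
  by apply/hasPn => -[a b]; rewrite !mem_spokes /=; case: a b => [|[]|j] [|[]|k].
rewrite !andbT; apply/hasPn => -[a b].
rewrite -[(a, b)]swapK (mem_map (inv_inj (@swapK _))) !mem_cat !mem_spokes /=.
by case: a b => [|[]|j] [|[]|k].
Qed.

(** If all adjacencies of the wheel occur and there is no room for more darts,
    then each adjacency occurs exactly once. *)
Lemma arcs_count N (P : fourvalent_map) (e : P -> site * site) :
  #|P| = 4 * N + 4 -> (forall a b, adjacent N a b -> exists d, e d = (a, b)) ->
  injective e /\ forall d, adjacent N (e d).1 (e d).2.
Proof.
move=> cP ex.
have sub : {subset arcs N <= [seq e d | d <- enum P]}.
  case=> a b; rewrite mem_arcs => /ex[d <-]; apply: map_f; exact: mem_enum.
have sz : size [seq e d | d <- enum P] <= size (arcs N).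
  by rewrite size_map -cardE cP size_arcs.
have [_ eqm] := uniq_min_size (uniq_arcs N) sub sz.
have ue := leq_size_uniq (uniq_arcs N) sub sz.
split; last first.
  by move=> d; rewrite -mem_arcs -surjective_pairing eqm map_f ?mem_enum.
exact/injectiveP.
Qed.

(** [e] gives the coordinates of a wheel with [N] spokes on [P]: [e d] consists
    of the regions on the left and on the right of [d]. *)
Record wheel (N : nat) (P : fourvalent_map) (e : P -> site * site) : Prop := Wheel {
  wheel_inj : injective e;
  wheel_im : forall a b, adjacent N a b <-> exists d, e d = (a, b);
  wheel_edge : forall d, e (edge d) = swap (e d);
  wheel_face : forall d, e (face d) = ((e d).1, turn N (e d).1 (e d).2)
}.

Lemma wheel_adjacent N (P : fourvalent_map) e (d : P) : wheel N e -> adjacent N (e d).1 (e d).2.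
Proof. by case=> _ im _ _; apply/im; exists d; case: (e d). Qed.

Lemma wheel_transfer N (P Q : fourvalent_map) (e : P -> _) (e' : Q -> _) :
  wheel N e -> wheel N e' ->
  exists h : P -> Q, forall d, e' (h d) = e d.
Proof.
move=> wP wQ; have ex d : exists d', e' d' == e d.
  have := wheel_adjacent d wP; case: (e d) => a b /(wheel_im wQ)[d' ed'].
  by exists d'; rewrite ed'.
by exists (fun d => xchoose (ex d)) => d; apply/eqP/(xchooseP (ex d)).
Qed.

Lemma wheel_unique N (P Q : fourvalent_map) (e : P -> _) (e' : Q -> _) :
  wheel N e -> wheel N e' -> same_projection P Q.
Proof.
move=> wP wQ; have [h eh] := wheel_transfer wP wQ; have [g eg] := wheel_transfer wQ wP.
have hE d : h (edge d) = edge (h d).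
  by apply: (wheel_inj wQ); rewrite eh (wheel_edge wP) (wheel_edge wQ) eh.
have hF d : h (face d) = face (h d).
  by apply: (wheel_inj wQ); rewrite eh (wheel_face wP) (wheel_face wQ) eh.
exists h; split => //.
  exists g => d; first by apply: (wheel_inj wP); rewrite eg eh.
  by apply: (wheel_inj wQ); rewrite eh eg.
(* [node] is recovered from [face] and [edge], see [node_face]. *)
left=> d; have [d' ->] : exists d', d = face d'.
  by exists (edge (node d)); rewrite /face edgeK finv_f //; apply: node_inj.
by rewrite hF !node_face hE.
Qed.

(** Being a wheel does not depend on the orientation of the sphere.  For an
    orientation reversing isomorphism [h], the left side of [d] is sent to the
    right side of [h d], that is, to the left side of [edge (h d)]. *)
Lemma wheel_same N (P Q : fourvalent_map) e : 1 < N -> same_projection P Q -> @wheel N Q e ->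
  exists e' : P -> site * site, wheel N e'.
Proof.
move=> N1 [h [[g hg gh] hE hN]] [inj im eE eF].
have h_inj : injective h := can_inj hg.
case: hN => hN.
  have hF d : h (face d) = face (h d).
    by apply: (@node_inj Q); rewrite -hN !node_face hE.
  exists (e \o h); split => /=; first exact: inj_comp.
  - move=> a b; split => [/im[d <-]|[d ed]]; first by exists (g d); rewrite /= gh.
    by apply/im; exists (h d).
  - by move=> d; rewrite hE eE.
  - by move=> d; rewrite hF eF.
pose mir x : site * site := (mirror x.1, mirror x.2).
have mirK : involutive mir by case=> a b; rewrite /mir /= !mirrorK.
pose r d := edge (h d).
have r_inj : injective r by move=> d d' /(inv_inj (@edgeK Q)) /h_inj.
have rF d : face (r (face d)) = r d.
  by rewrite {1}/r /face edgeK -hN -/(face d) node_face hE.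
exists (mir \o e \o r); split => /=.
- exact: inj_comp (inj_comp (inv_inj mirK) inj) r_inj.
- move=> a b; rewrite -adjacent_mirror; split => [/im[d ed]|[d /(congr1 mir)]].
    by exists (g (edge d)); rewrite /r /= gh edgeK ed /mir /= !mirrorK.
  by rewrite mirK => ed; apply/im; exists (r d).
- by move=> d; rewrite {1}/r hE -/(r d) eE.
move=> d; have := eF (r (face d)); rewrite rF.
have := wheel_adjacent (r (face d)) (Wheel inj im eE eF).
case: (e (r (face d))) => a b /= /(turnK N1) {2}<- -> /=.
by rewrite /mir /= /unturn mirrorK.
Qed.

(** * The twist projection is a wheel *)

Section TwistCoordinates.

Variables (n : nat) (n_ge4 : 3 < n).
Let N := n.-1.

(** The upper hub lies between [a] and the row, the lower hub between [b] and
    the row.  The triangle at the east end is [Spoke 0], the one at the west end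
    is [Spoke 1], and then come the bigons of the row from west to east; the
    bigon between [t_(i+1)] and [t_(i+2)] is [Spoke (i + 2)].  The clasp bigon
    is the unbounded region. *)
Definition twist_coord (d : twist_map n) : site * site :=
  match d with
  | (inl true, (true, true)) => (Clasp, Spoke 0)
  | (inl true, (true, false)) => (Spoke 1, Clasp)
  | (inl true, (false, false)) => (Hub true, Spoke 1)
  | (inl true, (false, true)) => (Spoke 0, Hub true)
  | (inl false, (true, true)) => (Hub false, Spoke 0)
  | (inl false, (true, false)) => (Spoke 1, Hub false)
  | (inl false, (false, false)) => (Clasp, Spoke 1)
  | (inl false, (false, true)) => (Spoke 0, Clasp)
  | (inr i, (true, true)) => (Hub true, Spoke (up N i.+1))
  | (inr i, (true, false)) => (Spoke i.+1, Hub true)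
  | (inr i, (false, false)) => (Hub false, Spoke i.+1)
  | (inr i, (false, true)) => (Spoke (up N i.+1), Hub false)
  end.

Let up_ord (i : 'I_(n - 3).+1) : up N i.+1 = if i == ord_max then 0 else i.+2.
Proof. by rewrite /up -val_eqE /N /=; congr (if _ then _ else _); lia. Qed.

Lemma twist_coord_edge d : twist_coord (edge d) = swap (twist_coord d).
Proof.
case: d => [[u|i] [v h]].
  by have := up_ord ord_max; rewrite eqxx /= => um; case: u v h => [] [] [] //=; rewrite um.
case: h => /=.
  have [ei|ni] := eqVneq i ord_max; first by case: v; rewrite /= ?up_ord ei ?eqxx.
  have lti : i.+1 < (n - 3).+1.
    by rewrite ltn_neqAle (ltn_ord i) eqSS andbT; apply: contraNneq ni => e; apply/eqP/val_inj.
  by case: v => /=; rewrite up_ord (negbTE ni) inordK.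
have [ei|ni] := eqVneq i ord0; first by case: v; rewrite /= ei.
have i0 : 0 < i by rewrite lt0n; apply: contraNneq ni => e; apply/eqP/val_inj.
have := ltn_ord i => li.
have e : up N (@inord (n - 3) i.-1).+1 = i.+1.
  by rewrite inordK /up /N; [rewrite prednK //; case: eqP => //; lia|lia].
by case: v => /=; rewrite e.
Qed.

(** As [node (face d) = edge d], this describes [face] without inverting
    [node]. *)
Lemma twist_coord_node d :
  twist_coord d =
  ((twist_coord (node d)).2, turn N (twist_coord (node d)).2 (twist_coord (node d)).1).
Proof.
have u0 : up N 0 = 1 by rewrite /up /N; case: eqP => //; lia.
case: d => [[u|i] [v h]] /=; first by case: u v h => [] [] [] //=; rewrite u0.
have := up_ord i; case: (i == ord_max) => e; case: v h => [] [] //=; rewrite ?e //.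
- by case: (nat_of_ord i).
- by congr (_, Spoke _); move: e; rewrite /up /down /=; case: eqP => // <-.
by case: (nat_of_ord i).
Qed.

Lemma twist_coord_ex a b : adjacent N a b -> exists d, twist_coord d = (a, b).
Proof.
have main s j : j < N -> exists d, twist_coord d = (Hub s, Spoke j).
  move=> ltj; case: s.
    have [->|j0] := posnP j.
      by exists (inr ord_max, (true, true)) => /=; have := up_ord ord_max; rewrite eqxx /= => ->.
    have [->|j1] := eqVneq j 1; first by exists (inl true, (false, false)).
    exists (inr (inord (j - 2)), (true, true)) => /=; congr (_, Spoke _).
    rewrite inordK; last by move: ltj; rewrite /N; lia.
    by rewrite /up; case: eqP; lia.
  have [->|j0] := posnP j; first by exists (inl false, (true, true)).
  exists (inr (inord j.-1), (false, false)) => /=; congr (_, Spoke _).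
  by rewrite inordK; move: ltj; rewrite /N; lia.
have clasp j : j < 2 -> exists d, twist_coord d = (Clasp, Spoke j).
  by case: j => [|[|//]] _; [exists (inl true, (true, true)) | exists (inl false, (false, false))].
have rev_ex a' b' : (exists d, twist_coord d = (b', a')) -> exists d, twist_coord d = (a', b').
  by case=> d ed; exists (edge d); rewrite twist_coord_edge ed.
case: a b => [|s|j] [|t|k] //= h; [exact: clasp|exact: main| |];
  apply: rev_ex; [exact: clasp|exact: main].
Qed.

Lemma twist_wheel : wheel N twist_coord.
Proof.
have card_twist : #|twist_map n| = 4 * N + 4.
  by rewrite !card_prod card_sum card_bool card_ord /N; lia.
have [inj adj] := arcs_count card_twist twist_coord_ex.
split=> //; last first.
- by move=> d; rewrite [LHS]twist_coord_node node_face twist_coord_edge.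
- exact: twist_coord_edge.
move=> a b; split=> [|[d ed]]; first exact: twist_coord_ex.
by have := adj d; rewrite ed.
Qed.

End TwistCoordinates.

(** * Passes through the regions of a wheel *)

Lemma order_eq (T : finType) (f : T -> T) x n :
  0 < n -> iter n f x = x -> (forall k, 0 < k < n -> iter k f x <> x) ->
  injective f -> order f x = n.
Proof.
move=> n0 fn fk f_inj; apply/eqP; rewrite eqn_leq; apply/andP; split.
  rewrite leqNgt; apply/negP => /findex_iter.
  by rewrite fn findex0 => e; rewrite -e in n0.
rewrite leqNgt; apply/negP => lt; case: (fk (order f x)); rewrite ?lt ?order_gt0 //.
exact: iter_order.
Qed.

Local Notation pass := (site * site * bool)%type.

Section Regions.

Variable N : nat.
Hypothesis N_gt2 : 2 < N.

Definition region_size (a : site) : nat :=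
  match a with Clasp => 2 | Hub _ => N | Spoke j => if j < 2 then 3 else 2 end.

Lemma iter_up k j : j < N -> k <= N ->
  iter k (turn N (Hub true)) (Spoke j) = Spoke (if j + k < N then j + k else j + k - N).
Proof.
move=> lj; elim: k => [|k IHk] lk; first by rewrite addn0 lj.
rewrite iterS IHk /=; last by lia.
by congr Spoke; rewrite /up; case: (ltnP (j + k) N); case: (ltnP (j + k.+1) N) => ? ?; case: eqP; lia.
Qed.

Lemma iter_down k j : j < N -> k <= N ->
  iter k (turn N (Hub false)) (Spoke j) = Spoke (if k <= j then j - k else j + N - k).
Proof.
move=> lj; elim: k => [|k IHk] lk; first by rewrite subn0.
rewrite iterS IHk /=; last by lia.
by congr Spoke; rewrite /down; case: (leqP k j); case: (leqP k.+1 j) => ? ?; case: eqP; lia.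
Qed.

Lemma iter_turn_size a b : adjacent N a b -> iter (region_size a) (turn N a) b = b.
Proof.
case: a => [|s|[|[|j]]]; case: b => [|[]|k] //= lk.
  by congr Spoke; lia.
by case: s; rewrite ?iter_up ?iter_down //; congr Spoke; case: ifP; lia.
Qed.

Lemma iter_turn_neq a b k : adjacent N a b -> 0 < k < region_size a ->
  iter k (turn N a) b <> b.
Proof.
case: a => [|s|[|[|j]]]; case: b => [|[]|l] //= ll.
all: try by case: k => [|[|[|k]]].
- by case: k => [|[|k]] // _ /= [] ; lia.
- by case: s => lk; rewrite ?iter_up ?iter_down; try lia; case; case: ifP; lia.
Qed.

Lemma iter_turn_reach a b c : adjacent N a b -> adjacent N a c ->
  exists k, iter k (turn N a) b = c.
Proof.
case: a => [|s|[|[|j]]]; case: b => [|[]|k] //= lk; case: c => [|[]|l] //= ll.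
all: try by [exists 0 | exists 1 | exists 2].
  case: (k =P l) => [->|kl]; first by exists 0.
  by exists 1 => /=; congr Spoke; lia.
case: s; [case: (leqP k l) | case: (leqP l k)] => kl;
  [exists (l - k) | exists (l + N - k) | exists (k - l) | exists (k + N - l)];
  rewrite ?iter_up ?iter_down; try lia; by congr Spoke; case: ifP; lia.
Qed.

(** The maps [opposite], [across] and [step], in coordinates: a pass [(a, b, t)]
    is about to enter the region [a], across the edge shared with [b] if [t],
    and otherwise at the corner between the edge shared with [b] and the
    preceding edge in the boundary walk of [a]. *)
Definition wheel_opposite (x : pass) : pass :=
  let: (a, b, t) := x in
  let k := (region_size a)./2 in
  if odd (region_size a)
  then if t then (a, iter k.+1 (turn N a) b, false) else (a, iter k (turn N a) b, true)
  else (a, iter k (turn N a) b, t).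

Definition wheel_across (x : pass) : pass :=
  let: (a, b, t) := x in
  if t then (b, a, t)
  else let c := unturn N a b in (unturn N c a, c, t).

Definition wheel_step x := wheel_across (wheel_opposite x).

Variables (P : fourvalent_map) (e : P -> site * site).
Hypothesis wP : wheel N e.

Let N_gt1 : 1 < N. Proof. exact: ltnW. Qed.

Lemma wheel_iter_face k d :
  e (iter k (@face P) d) = ((e d).1, iter k (turn N (e d).1) (e d).2).
Proof.
elim: k => [|k IH]; first exact: surjective_pairing.
by rewrite iterS (wheel_face wP) IH.
Qed.

Lemma wheel_nsides d : nsides d = region_size (e d).1.
Proof.
have adj := wheel_adjacent d wP.
apply: order_eq; [|apply: (wheel_inj wP)| |exact: face_inj].
- by case: (e d).1 => [|s|j] //=; [apply: ltnW|case: ifP].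
- by rewrite wheel_iter_face iter_turn_size // -surjective_pairing.
move=> k lk ed; apply: (iter_turn_neq adj lk).
by have := wheel_iter_face k d; rewrite ed; case: (e d) => a b [].
Qed.

Lemma wheel_node d :
  e (node d) = (unturn N (e d).1 (e d).2, (e d).1).
Proof.
have [d' ed'] : exists d', d = face d'.
  by exists (edge (node d)); rewrite /face edgeK finv_f //; apply: node_inj.
have adj := wheel_adjacent d' wP.
rewrite ed' node_face (wheel_edge wP) (wheel_face wP) /swap.
by rewrite turnK.
Qed.

(** The coordinates of an item. *)
Definition item_coord (x : item P) : pass := (e x.1, x.2).

Lemma item_coord_inj : injective item_coord.
Proof. by move=> [d t] [d' t'] [] /(wheel_inj wP) -> ->. Qed.

Lemma item_coord_opposite x : item_coord (opposite x) = wheel_opposite (item_coord x).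
Proof.
rewrite /item_coord oppositeE /= wheel_nsides.
case: x => d t /=; case ed: (e d) => [a b] /=.
by case: (odd _); [case: t|]; rewrite /= ?(wheel_face wP) wheel_iter_face ed.
Qed.

Lemma item_coord_across x : item_coord (across x) = wheel_across (item_coord x).
Proof.
case: x => d [] /=; rewrite /item_coord /across /=.
  by rewrite (wheel_edge wP) /swap; case: (e d).
by rewrite !wheel_node /=; case: (e d).
Qed.

Lemma item_coord_step x : item_coord (step x) = wheel_step (item_coord x).
Proof. by rewrite item_coord_across item_coord_opposite. Qed.

Lemma wheel_lettering (T : eqType) (l : site -> T) :
  (forall a b a' b', adjacent N a b -> adjacent N a' b' -> l a = l a' -> a = a') ->
  region_lettering (fun d => l (e d).1).
Proof.
move=> l_inj d d'; have adj := wheel_adjacent d wP; have adj' := wheel_adjacent d' wP.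
split=> [/(l_inj _ _ _ _ adj adj') ea|/iter_findex <-]; last by rewrite wheel_iter_face.
rewrite -ea in adj'; have [k ek] := iter_turn_reach adj adj'.
suff -> : d' = iter k (@face P) d by apply: fconnect_iter.
by apply: (wheel_inj wP); rewrite wheel_iter_face ek ea -surjective_pairing.
Qed.

(** A closed curve of the wheel, as the list of its passes. *)
Definition wheel_cycle (s : seq pass) : Prop :=
  [/\ fcycle wheel_step s, uniq s & if s is x :: _ then adjacent N x.1.1 x.1.2 : Prop else False].

(** The signed word read along a closed curve, regions being labelled by [l]. *)
Definition cycle_word (T : Type) (l : site -> T) (s : seq pass) : word T :=
  (if s is x :: _ then x.2 else false, [seq l x.1.1 | x <- s]).

Lemma wheel_cycle_orbit s : wheel_cycle s ->
  exists x, [seq item_coord y | y <- orbit (@step P) x] = s.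
Proof.
case: s => [|[[a b] t] s] [] // cyc us /(wheel_im wP)[d ed].
exists (d, t); set x := (d, t).
have ex : item_coord x = (a, b, t) by rewrite /item_coord ed.
have tr k : [seq item_coord y | y <- traject (@step P) x k] = traject wheel_step (a, b, t) k.
  elim: k (x) (a, b, t) ex {cyc us} => //= k IH y c ey.
  by rewrite ey (IH _ (wheel_step c)) // item_coord_step ey.
move: cyc us; rewrite [X in X -> _]/= rcons_path => /andP[/fpathP[k ->]].
rewrite -trajectS => /eqP; rewrite last_traject -iterS => ck us.
have -> : orbit (@step P) x = traject (@step P) x k.+1; last exact: tr.
rewrite trajectS; apply: orbit_fcycle.
  rewrite /= rcons_path fpath_traject last_traject /= -iterS.
  apply/eqP/item_coord_inj; rewrite ex -ck.
  elim: k.+1 => [|i IH]; first by rewrite ex.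
  by rewrite !iterS item_coord_step IH.
by rewrite -trajectS -(map_inj_uniq item_coord_inj) tr.
Qed.

Lemma wheel_card : #|P| = 4 * N + 4.
Proof.
rewrite -size_arcs cardE -(size_map e); apply: perm_size; apply: uniq_perm.
- by rewrite (map_inj_uniq (wheel_inj wP)) enum_uniq.
- exact: uniq_arcs.
move=> [a b]; rewrite mem_arcs; apply/mapP/idP => [[d _ ed]|/(wheel_im wP)[d ed]].
  by apply/(wheel_im wP); exists d.
by exists d; rewrite ?mem_enum.
Qed.

Lemma wheel_oppositeK a b t : adjacent N a b ->
  wheel_opposite (wheel_opposite (a, b, t)) = (a, b, t).
Proof.
case/(wheel_im wP) => d ed.
have -> : (a, b, t) = item_coord (d, t) by rewrite /item_coord ed.
by rewrite -!item_coord_opposite oppositeK.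
Qed.

(** A list of closed curves is the list of all axes if it covers every pass, up
    to direction, and has half as many passes as there are items: covering with
    this total length leaves no room for repetitions. *)
Lemma wheel_axis_system (T : eqType) (l : site -> T) (css : seq (seq pass)) :
  region_lettering (fun d => l (e d).1) ->
  (forall s, s \in css -> wheel_cycle s) ->
  size (flatten css) = 4 * N + 4 ->
  (forall a b t, adjacent N a b ->
     ((a, b, t) \in flatten css) || (wheel_opposite (a, b, t) \in flatten css)) ->
  axis_system_is (fun d => l (e d).1) [seq cycle_word l s | s <- css].
Proof.
move=> lettering cyc sz cov; apply/(axis_system_starts lettering).
have [starts es] : exists starts,
    [seq [seq item_coord y | y <- orbit (@step P) x] | x <- starts] = css.
  elim: (css) cyc => [|s c IH] cyc; first by exists [::].
  have [x ex] := wheel_cycle_orbit (cyc s (mem_head _ _)).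
  have [|st est] := IH; first by move=> s' s'c; apply: cyc; rewrite inE s'c orbT.
  by exists (x :: st); rewrite /= ex est.
have {}cov z : exists2 x, x \in starts & z \in axis x.
  have adj := wheel_adjacent z.1 wP.
  have : has (fun x => z \in axis x) starts; last by case/hasP => x; exists x.
  have := cov _ _ z.2 adj.
  have -> : ((e z.1).1, (e z.1).2, z.2) = item_coord z by rewrite -surjective_pairing.
  rewrite -item_coord_opposite -es; elim: (starts) => //= x st IH.
  rewrite !mem_cat !(mem_map item_coord_inj) -!fconnect_orbit in_axis orbACA.
  by case/orP => [->//|/IH ->]; rewrite orbT.
exists starts; last first.
  rewrite -es -map_comp; apply: eq_map => x /=.
  rewrite /axis_word /cycle_word -map_comp /item_coord.
  by rewrite [in X in _ = (X, _)]orbit_cons.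
(* [g x] lists the passes of the axis of [x] in both directions; concatenated,
   these lists have as many terms as there are items, so they are disjoint. *)
pose g x := orbit (@step P) x ++ [seq opposite y | y <- orbit (@step P) x].
have mem_g x y : (y \in g x) = (y \in axis x).
  rewrite in_axis mem_cat !fconnect_orbit; congr (_ || _).
  by rewrite -{1}[y]oppositeK mem_map //; apply: inv_inj (@oppositeK P).
have size_g st : size (flatten [seq g x | x <- st]) =
    2 * size (flatten [seq [seq item_coord y | y <- orbit (@step P) x] | x <- st]).
  by elim: st => //= x st IH; rewrite !size_cat IH !size_map mulnDr addnn -mul2n.
have uniq_g : uniq (flatten [seq g x | x <- starts]).
  apply: (leq_size_uniq (enum_uniq (item P))) => [z _|].
    by have [x xs zx] := cov z; apply/flattenP; exists (g x); rewrite ?map_f // mem_g.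
  by rewrite size_g es sz -cardE card_prod card_bool wheel_card mulnC.
apply: uniq_perm; [|exact: enum_uniq|]; last first.
- move=> X; rewrite mem_enum; apply/mapP/imsetP => [[x _ ->]|[z _ ->]]; first by exists x.
  by have [x xs /axis_eq zx] := cov z; exists x.
elim: (starts) uniq_g => //= x st IH; rewrite cat_uniq => /and3P[_ /hasPn dis /IH ->].
rewrite andbT; apply/mapP => -[y yst axy]; have /dis : y \in flatten [seq g z | z <- st].
  by apply/flattenP; exists (g y); rewrite ?map_f // mem_g mem_axis.
by rewrite /= mem_g axy mem_axis.
Qed.

End Regions.

(** * Closed curves on a wheel *)

(** Proves that the passes of an explicit curve are pairwise distinct. *)
Ltac distinct := rewrite /= ?inE ?negb_or; do ?[apply/andP; split]; try (by []);
  apply/eqP => -[]; lia.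

Lemma fpath_mkiota (T : eqType) (f : T -> T) (g : nat -> T) a k :
  (forall j, a <= j < a + k -> f (g j) = g j.+1) -> fpath f (g a) [seq g j | j <- iota a.+1 k].
Proof.
elim: k a => //= k IH a h; rewrite h ?eqxx /=; last by lia.
by apply: IH => j lj; apply: h; lia.
Qed.

Local Arguments wheel_step : simpl never.

Lemma last_iota a k : last a (iota a.+1 k) = a + k.
Proof. by elim: k a => [|k IH] a; rewrite ?addn0 //= IH addnS. Qed.

Section Steps.

Variable N : nat.
Hypothesis N_gt2 : 2 < N.

Lemma up0 : up N 0 = 1. Proof. by rewrite /up; case: eqP; lia. Qed.
Lemma up1 : up N 1 = 2. Proof. by rewrite /up; case: eqP; lia. Qed.

Lemma step_spoke_edge j s : 1 < j ->
  wheel_step N (Spoke j, Hub s, true) = (Hub (~~ s), Spoke j, true).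
Proof. by case: j => [|[|j]]. Qed.

Lemma step_spoke_corner j : 1 < j < N ->
  wheel_step N (Spoke j, Hub false, false) = (Spoke (up N j), Hub false, false).
Proof. by case: j => [|[|j]]. Qed.

Lemma across_upper j k : 0 < k < N -> up N k = j ->
  wheel_across N (Hub true, Spoke j, false) = (Hub false, Spoke k, false).
Proof.
move=> lk <-; have e : down N (up N k) = k by rewrite /up /down; case: (k.+1 =P N) => ? /=; lia.
by rewrite /wheel_across /unturn /= e; case: k lk {e} => [|[|k]].
Qed.

Lemma across_lower j k : k != 1 -> up N j = k ->
  wheel_across N (Hub false, Spoke j, false) = (Hub true, Spoke k, false).
Proof.
by move=> k1 ek; rewrite /wheel_across /unturn /= ek; case: k k1 {ek} => [|[|k]].
Qed.

Lemma across_lower0 : wheel_across N (Hub false, Spoke 0, false) = (Clasp, Spoke 1, false).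
Proof. by rewrite /wheel_across /unturn /= ?up0. Qed.

Lemma step_spoke0_upper_edge : wheel_step N (Spoke 0, Hub true, true) = (Spoke 1, Hub false, false).
Proof. by rewrite /wheel_step /= /unturn /= ?up0. Qed.

Lemma step_spoke1_clasp : wheel_step N (Spoke 1, Clasp, true) = (Spoke 2, Hub false, false).
Proof. by rewrite /wheel_step /= /unturn /= ?up1. Qed.

(** The curve through the clasp, across the edges shared with the triangles, and
    along the whole row.  The last pass, of index [N], is through
    [Spoke 0]. *)
Definition belt : seq pass :=
  [:: (Clasp, Spoke 0, true), (Spoke 1, Clasp, true)
    & [seq (Spoke (if j == N then 0 else j), Hub false, false) | j <- iota 2 N.-1]].

Lemma belt_cycle : wheel_cycle N belt.
Proof.
pose g j : pass := (Spoke (if j == N then 0 else j), Hub false, false).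
split=> //; last first.
  rewrite /belt !cons_uniq map_inj_in_uniq ?iota_uniq.
    rewrite andbT; apply/andP; split; last by apply/mapP => -[].
    by rewrite inE; apply/norP; split=> //; apply/mapP => -[].
  by move=> i j; rewrite !mem_iota => li lj []; case: (i =P N); case: (j =P N); lia.
have eN : N.-1 = (N - 2).+1 by lia.
have g2 : g 2 = (Spoke 2, Hub false, false) by rewrite /g; case: eqP => //; lia.
have gN : g N = (Spoke 0, Hub false, false) by rewrite /g eqxx.
have gS j : 2 <= j < 2 + (N - 2) -> wheel_step N (g j) = g j.+1.
  move=> lj; rewrite /g; case: eqP => ?; first lia.
  by rewrite step_spoke_corner //; lia.
rewrite /belt -/(map g _) eN [iota 2 _]/= [map g _]/= -/(map g _) /cycle rcons_path.
rewrite /= -/(map g _) -/(g 2) (fpath_mkiota gS) last_map last_iota.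
rewrite g2 step_spoke1_clasp eqxx andTb; apply/eqP.
by rewrite (_ : 2 + (N - 2) = N) ?gN //; lia.
Qed.

End Steps.

(** ** Curves for an even number of crossings *)

Section EvenCycles.

Variables m N : nat.
Hypotheses (m_gt1 : 1 < m) (eN : N = m.*2.-1).

Let N_gt2 : 2 < N. Proof. by lia. Qed.
Let oN : odd N. Proof. by lia. Qed.
Let hN : (N./2).+1 = m. Proof. by lia. Qed.

(** Opposite items of a hub with [2 * m - 1] sides are an edge and a corner.  The
    disjunctions express congruences modulo [N] between naturals below [N]. *)
Lemma even_upper_edge j k : j < N -> 0 < k < N -> j + m = k.+1 \/ j + m = k.+1 + N ->
  wheel_step N (Hub true, Spoke j, true) = (Hub false, Spoke k, false).
Proof.
move=> lj lk jk; rewrite /wheel_step /wheel_opposite [region_size _ _]/= oN hN iter_up //; last by lia.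
by apply: (across_upper N_gt2) => //; rewrite /up; case: (k.+1 =P N) => ?; case: (ltnP (j + m) N); lia.
Qed.

Lemma even_upper_corner j k : j < N -> k < N -> j + m = k.+1 \/ j + m = k.+1 + N ->
  wheel_step N (Hub true, Spoke j, false) = (Spoke k, Hub true, true).
Proof.
move=> lj lk jk; rewrite /wheel_step /wheel_opposite [region_size _ _]/= oN iter_up //; last by lia.
by rewrite /=; congr (Spoke _, _, _); case: ifP; lia.
Qed.

Lemma even_lower_edge j k : j < N -> k < N -> k != 1 -> k + m = j.+1 \/ k + m = j.+1 + N ->
  wheel_step N (Hub false, Spoke j, true) = (Hub true, Spoke k, false).
Proof.
move=> lj lk k1 jk; rewrite /wheel_step /wheel_opposite [region_size _ _]/= oN hN iter_down //; last by lia.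
apply: across_lower => //; rewrite /up; case: (leqP m j) => ?; by case: ((_.+1) =P N); lia.
Qed.

Lemma even_lower_clasp : wheel_step N (Hub false, Spoke m, true) = (Clasp, Spoke 1, false).
Proof.
rewrite /wheel_step /wheel_opposite [region_size _ _]/= oN hN iter_down; try lia.
by rewrite leqnn subnn across_lower0 //; lia.
Qed.

Lemma even_lower_corner j k : j < N -> k < N -> k + m = j.+1 \/ k + m = j.+1 + N ->
  wheel_step N (Hub false, Spoke j, false) = (Spoke k, Hub false, true).
Proof.
move=> lj lk jk; rewrite /wheel_step /wheel_opposite [region_size _ _]/= oN iter_down //; last by lia.
by rewrite /=; congr (Spoke _, _, _); case: ifP; lia.
Qed.

(** The curve [C0 I C1 O]. *)
Definition even_lens : seq pass :=
  [:: (Clasp, Spoke 1, false); (Hub true, Spoke 1, false);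
      (Spoke m, Hub true, true); (Hub false, Spoke m, true)].

(** The curve [L0 R0 I O R0 L0 O I]. *)
Definition even_eight : seq pass :=
  [:: (Spoke 0, Hub true, true); (Spoke 1, Hub false, false);
      (Hub true, Spoke 1, true); (Hub false, Spoke m, false);
      (Spoke 1, Hub false, true); (Spoke 0, Hub true, false);
      (Hub false, Spoke 0, true); (Hub true, Spoke m, false)].

(** The curve that crosses the bigon [Spoke j], other than the middle one
    [Spoke m], between the two hubs. *)
Definition even_triangle j : seq pass :=
  [:: (Spoke j, Hub false, true); (Hub true, Spoke j, true);
      (Hub false, Spoke (if j < m then j + m.-1 else j - m), false)].

Lemma even_lens_cycle : wheel_cycle N even_lens.
Proof.
split; [rewrite /=|by distinct|by rewrite /=; lia].
rewrite (@even_upper_corner _ m) ?step_spoke_edge ?even_lower_clasp ?eqxx //; lia.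
Qed.

Lemma even_eight_cycle : wheel_cycle N even_eight.
Proof.
split; [rewrite /=|by distinct|by rewrite /=; lia].
rewrite ?step_spoke0_upper_edge ?(@even_upper_edge _ m) ?(@even_lower_corner _ 1)
 ?(@even_lower_edge _ m) ?(@even_upper_corner _ 0) ?eqxx //; lia.
Qed.

Lemma even_triangle_cycle j : 1 < j < N -> j != m -> wheel_cycle N (even_triangle j).
Proof.
move=> lj jm; rewrite /even_triangle.
set k := if j < m then _ else _.
have ek : j + m = k.+1 \/ j + m = k.+1 + N by rewrite /k; case: ltnP; lia.
have lk : 0 < k < N by rewrite /k; case: (ltnP j m); lia.
split; [rewrite /=|by distinct|by rewrite /=; lia].
by rewrite ?step_spoke_edge ?(@even_upper_edge _ k) ?(@even_lower_corner _ j) ?eqxx //; lia.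
Qed.

End EvenCycles.

(** ** Curves for an odd number of crossings *)

Section OddCycles.

Variables m N : nat.
Hypotheses (m_gt1 : 1 < m) (eN : N = m.*2).

Let N_gt2 : 2 < N. Proof. by lia. Qed.
Let oN : odd N = false. Proof. by lia. Qed.
Let hN : N./2 = m. Proof. by lia. Qed.

(** Opposite items of a hub with [2 * m] sides are of the same kind and [m]
    spokes apart. *)
Lemma odd_upper_edge j k : j < N -> k < N -> j + m = k \/ j + m = k + N ->
  wheel_step N (Hub true, Spoke j, true) = (Spoke k, Hub true, true).
Proof.
move=> lj lk jk; rewrite /wheel_step /wheel_opposite [region_size _ _]/= oN hN iter_up //; last by lia.
by rewrite /=; congr (Spoke _, _, _); case: ifP; lia.
Qed.

Lemma odd_upper_corner j k : j < N -> 0 < k < N -> j + m = k.+1 \/ j + m = k.+1 + N ->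
  wheel_step N (Hub true, Spoke j, false) = (Hub false, Spoke k, false).
Proof.
move=> lj lk jk; rewrite /wheel_step /wheel_opposite [region_size _ _]/= oN hN iter_up //; last by lia.
by apply: (across_upper N_gt2) => //; rewrite /up; case: (k.+1 =P N) => ?; case: (ltnP (j + m) N); lia.
Qed.

Lemma odd_lower_edge j k : j < N -> k < N -> k + m = j \/ k + m = j + N ->
  wheel_step N (Hub false, Spoke j, true) = (Spoke k, Hub false, true).
Proof.
move=> lj lk jk; rewrite /wheel_step /wheel_opposite [region_size _ _]/= oN hN iter_down //; last by lia.
by rewrite /=; congr (Spoke _, _, _); case: ifP; lia.
Qed.

Lemma odd_lower_corner j k : j < N -> k < N -> k != 1 -> k + m = j.+1 \/ k + m = j.+1 + N ->
  wheel_step N (Hub false, Spoke j, false) = (Hub true, Spoke k, false).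
Proof.
move=> lj lk k1 jk; rewrite /wheel_step /wheel_opposite [region_size _ _]/= oN hN iter_down //; last by lia.
apply: across_lower => //; rewrite /up; case: (leqP m j) => ?; by case: ((_.+1) =P N); lia.
Qed.

Lemma odd_lower_clasp : wheel_step N (Hub false, Spoke m, false) = (Clasp, Spoke 1, false).
Proof.
rewrite /wheel_step /wheel_opposite [region_size _ _]/= oN hN iter_down; try lia.
by rewrite leqnn subnn across_lower0 //; lia.
Qed.

(** The curve [C0 I O]. *)
Definition odd_lens : seq pass :=
  [:: (Clasp, Spoke 1, false); (Hub true, Spoke 1, false); (Hub false, Spoke m, false)].

(** The curve [L0 R0 I L_(m-1) O R0 L0 O R_(m-1) I]. *)
Definition odd_eight : seq pass :=
  [:: (Spoke 0, Hub true, true); (Spoke 1, Hub false, false);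
      (Hub true, Spoke 1, true); (Spoke m.+1, Hub true, true);
      (Hub false, Spoke m.+1, true); (Spoke 1, Hub false, true);
      (Spoke 0, Hub true, false); (Hub false, Spoke 0, true);
      (Spoke m, Hub false, true); (Hub true, Spoke m, true)].

(** The curve [I O] that enters the upper hub at the corner before its edge
    shared with [Spoke j]. *)
Definition odd_pair j : seq pass :=
  [:: (Hub true, Spoke j, false); (Hub false, Spoke (j + m.-1), false)].

(** The curve that crosses the bigon [Spoke j] and the bigon opposite to it on
    the hubs. *)
Definition odd_square j : seq pass :=
  [:: (Spoke j, Hub false, true); (Hub true, Spoke j, true);
      (Spoke (j - m), Hub true, true); (Hub false, Spoke (j - m), true)].

Lemma odd_lens_cycle : wheel_cycle N odd_lens.
Proof.
split; [rewrite /=|by distinct|by rewrite /=; lia].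
by rewrite (@odd_upper_corner _ m) ?odd_lower_clasp ?eqxx //; lia.
Qed.

Lemma odd_eight_cycle : wheel_cycle N odd_eight.
Proof.
split; [rewrite /=|by distinct|by rewrite /=; lia].
rewrite ?step_spoke0_upper_edge ?(@odd_upper_edge 1 m.+1) ?step_spoke_edge ?(@odd_lower_edge m.+1 1)
  ?(@odd_lower_edge 0 m) ?(@odd_upper_edge m 0) ?eqxx //; lia.
Qed.

Lemma odd_pair_cycle j : 1 < j <= m -> wheel_cycle N (odd_pair j).
Proof.
move=> lj; split; [rewrite /=|by distinct|by rewrite /=; lia].
by rewrite (@odd_upper_corner j (j + m.-1)) ?(@odd_lower_corner (j + m.-1) j) ?eqxx //; lia.
Qed.

Lemma odd_square_cycle j : m.+1 < j < N -> wheel_cycle N (odd_square j).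
Proof.
move=> lj; split; [rewrite /=|by distinct|by rewrite /=; lia].
by rewrite ?step_spoke_edge ?(@odd_upper_edge j (j - m)) ?(@odd_lower_edge (j - m) j) ?eqxx //; lia.
Qed.

End OddCycles.

(** * The axis system of a wheel *)

Lemma size_flatten_map (T S : Type) (f : T -> seq S) c (s : seq T) :
  (forall x, size (f x) = c) -> size (flatten [seq f x | x <- s]) = c * size s.
Proof. by move=> h; elim: s => [|x s IH] /=; rewrite ?muln0 // size_cat h IH mulnS. Qed.

Lemma rev_map_iota (T : Type) (f : nat -> T) b k : k <= b.+1 ->
  rev [seq f i | i <- iota 0 k] = [seq f (b - j) | j <- iota (b.+1 - k) k].
Proof.
move=> kb; apply: (@eq_from_nth _ (f 0)); first by rewrite size_rev !size_map !size_iota.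
move=> i; rewrite size_rev size_map size_iota => ik.
rewrite nth_rev size_map size_iota // !(nth_map 0) ?size_iota ?nth_iota; try lia.
by congr f; lia.
Qed.

Section Coverage.

Variables (N : nat) (P : fourvalent_map) (e : P -> site * site).
Hypotheses (N_gt2 : 2 < N) (wP : wheel N e).
Variable css : seq (seq pass).

(** The pass [c], in one direction or the other, is on one of the curves. *)
Definition covered c := (c \in flatten css) || (wheel_opposite N c \in flatten css).

Lemma covered_opposite a b t c : wheel_opposite N (a, b, t) = c -> adjacent N a b ->
  covered c -> covered (a, b, t).
Proof. by move=> <- adj; rewrite /covered (wheel_oppositeK N_gt2 wP) // orbC. Qed.

Lemma covered_mem s c : s \in css -> c \in s -> covered c.
Proof. by move=> ss cs; apply/orP; left; apply/flattenP; exists s. Qed.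

Lemma mem_belt j : 1 < j < N -> (Spoke j, Hub false, false) \in belt N.
Proof.
move=> lj; rewrite !inE; apply/orP; right; apply/orP; right; apply/mapP.
by exists j; [rewrite mem_iota; lia|case: eqP => // ?; lia].
Qed.

Lemma mem_belt0 : (Spoke 0, Hub false, false) \in belt N.
Proof.
rewrite !inE; apply/orP; right; apply/orP; right; apply/mapP.
by exists N; [rewrite mem_iota; lia|rewrite eqxx].
Qed.

(** Outside the hubs it is enough to look at a few passes, since all the spokes
    of index at least 2 are crossed at corners by [belt]. *)
Lemma covered_all eight :
  belt N \in css -> eight \in css ->
  {subset [:: (Spoke 0, Hub true, true); (Spoke 0, Hub true, false);
              (Spoke 1, Hub false, true); (Spoke 1, Hub false, false)] <= eight} ->
  covered (Clasp, Spoke 1, false) ->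
  (forall j, 1 < j < N -> covered (Spoke j, Hub false, true)) ->
  (forall s j t, j < N -> covered (Hub s, Spoke j, t)) ->
  forall a b t, adjacent N a b -> covered (a, b, t).
Proof.
move=> beltP eightP sub clasp spoke hub.
have in8 c : c \in [:: (Spoke 0, Hub true, true); (Spoke 0, Hub true, false);
              (Spoke 1, Hub false, true); (Spoke 1, Hub false, false)] -> covered c.
  by move=> /sub; apply: covered_mem.
have inb c : c \in belt N -> covered c by apply: covered_mem.
case=> [|s|[|[|j]]] [|u|k] t //= adj.
- case: k t adj => [|[|//]] [] adj //.
  + exact: inb.
  + exact: (covered_opposite erefl).
  + by apply: (covered_opposite erefl) => //; apply: inb.
- exact: hub.
- case: t; apply: (covered_opposite erefl) => //; [exact/inb/mem_belt0|exact: in8].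
- case: u t => [] []; try exact: in8; last exact/inb/mem_belt0.
  by apply: (covered_opposite erefl) => //; apply: in8.
- case: t; first exact: inb.
  by apply: (covered_opposite erefl) => //; apply: in8.
- case: u t => [] []; try exact: in8; apply: (covered_opposite erefl) => //; [exact: in8|exact: inb].
case: u t => [] []; [| |exact: spoke|exact/inb/mem_belt];
  apply: (covered_opposite erefl) => //; [exact: spoke|exact/inb/mem_belt].
Qed.

End Coverage.

(** ** Axes for an even number of crossings *)

Section EvenSystem.

Variables (m N : nat) (P : fourvalent_map) (e : P -> site * site).
Hypotheses (m_gt1 : 1 < m) (eN : N = m.*2.-1) (wP : wheel N e).

Let N_gt2 : 2 < N. Proof. by lia. Qed.
Let oN : odd N. Proof. by lia. Qed.
Let hN : (N./2).+1 = m. Proof. by lia. Qed.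

Lemma even_upper_opposite j k : j < N -> k < N -> j + m = k \/ j + m = k + N ->
  wheel_opposite N (Hub true, Spoke j, true) = (Hub true, Spoke k, false).
Proof.
move=> lj lk jk; rewrite /wheel_opposite [region_size _ _]/= oN hN iter_up //; last by lia.
by congr (_, Spoke _, _); case: ifP; lia.
Qed.

Lemma even_lower_opposite j k : j < N -> k < N -> k + m = j \/ k + m = j + N ->
  wheel_opposite N (Hub false, Spoke j, true) = (Hub false, Spoke k, false).
Proof.
move=> lj lk jk; rewrite /wheel_opposite [region_size _ _]/= oN hN iter_down //; last by lia.
by congr (_, Spoke _, _); case: ifP; lia.
Qed.

(** The axes, in the order of [twist_words_even]. *)
Definition even_cycles : seq (seq pass) :=
  [:: belt N; even_lens m; even_eight m]
  ++ [seq even_triangle m i.+1 | i <- iota 1 (m - 2)]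
  ++ [seq even_triangle m (N - i) | i <- iota 1 (m - 2)].

Lemma even_cyclesP s : s \in even_cycles -> wheel_cycle N s.
Proof.
rewrite mem_cat !inE mem_cat => /or3P[/or3P[] /eqP->|/mapP[i]|/mapP[i]].
- exact: belt_cycle.
- exact: even_lens_cycle.
- exact: even_eight_cycle.
- by rewrite mem_iota => li ->; apply: even_triangle_cycle; lia.
by rewrite mem_iota => li ->; apply: even_triangle_cycle; lia.
Qed.

Lemma size_even_cycles : size (flatten even_cycles) = 4 * N + 4.
Proof.
rewrite /even_cycles !flatten_cat !size_cat !(@size_flatten_map _ _ _ 3) // !size_iota.
by rewrite /= size_map size_iota; lia.
Qed.

Lemma mem_even_triangle j : 1 < j < N -> j != m -> even_triangle m j \in even_cycles.
Proof.
move=> lj jm; rewrite !mem_cat; apply/orP; right; apply/orP.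
have [ltj|lej] := ltnP j m.
  by left; apply/mapP; exists j.-1; rewrite ?mem_iota ?prednK //; lia.
by right; apply/mapP; exists (N - j); rewrite ?mem_iota ?subKn //; lia.
Qed.

Lemma even_covered a b t : adjacent N a b -> covered N even_cycles (a, b, t).
Proof.
have A2 c : c \in even_lens m -> covered N even_cycles c.
  by apply: covered_mem; rewrite !inE eqxx orbT.
have A3 c : c \in even_eight m -> covered N even_cycles c.
  by apply: covered_mem; rewrite !inE eqxx !orbT.
have B j c : 1 < j < N -> j != m -> c \in even_triangle m j -> covered N even_cycles c.
  by move=> lj jm; apply: covered_mem; apply: mem_even_triangle.
have opp a' b' t' c (eo : wheel_opposite N (a', b', t') = c) :=
  @covered_opposite _ _ _ N_gt2 wP even_cycles _ _ _ _ eo.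
have edge s j : j < N -> covered N even_cycles (Hub s, Spoke j, true).
  move=> lj; have [j0|j1] := leqP j 1.
    case: s; case: j j0 lj => [|[|//]] _ lj.
    - apply: (opp _ _ _ _ (@even_upper_opposite 0 m _ _ _)) => //; try lia.
      by apply: A3; rewrite !inE eqxx !orbT.
    - by apply: A3; rewrite !inE eqxx !orbT.
    - by apply: A3; rewrite !inE eqxx !orbT.
    apply: (opp _ _ _ _ (@even_lower_opposite 1 m _ _ _)) => //; try lia.
    by apply: A3; rewrite !inE eqxx !orbT.
  have [->|jm] := eqVneq j m.
    case: s; last by apply: A2; rewrite !inE eqxx !orbT.
    apply: (opp _ _ _ _ (@even_upper_opposite m 1 _ _ _)) => //; try (by rewrite /=; lia).
    by apply: A2; rewrite !inE eqxx !orbT.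
  case: s; first by apply: (B j); rewrite ?j1 // !inE eqxx !orbT.
  apply: (opp _ _ _ _ (@even_lower_opposite j (if j < m then j + m.-1 else j - m) _ _ _)) => //;
    try by case: (ltnP j m); lia.
  by apply: (B j); rewrite ?j1 // !inE eqxx !orbT.
apply: (@covered_all _ _ _ N_gt2 wP _ (even_eight m)); rewrite ?inE ?eqxx ?orbT //.
- by move=> c; rewrite !inE => /or4P[] /eqP ->; rewrite eqxx ?orbT.
- by apply: A2; rewrite !inE eqxx.
- move=> j lj; have [->|jm] := eqVneq j m.
    apply: (opp _ _ _ (Spoke m, Hub true, true)); [by case: (m) m_gt1 => [|[|]]|rewrite /=; lia|].
    by apply: A2; rewrite !inE eqxx !orbT.
  by apply: (B j) => //; rewrite !inE eqxx.
move=> s j [] lj; first exact: edge.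
case: s.
  set k := if m <= j then j - m else j + N - m.
  have lk : k < N by rewrite /k; case: (leqP m j); lia.
  have eo : wheel_opposite N (Hub true, Spoke k, true) = (Hub true, Spoke j, false).
    by apply: even_upper_opposite; rewrite // /k; case: (leqP m j); lia.
  apply: (opp _ _ _ (Hub true, Spoke k, true)) => //; last exact: edge.
  by rewrite -eo (wheel_oppositeK N_gt2 wP).
set k := if j + m < N then j + m else j + m - N.
have lk : k < N by rewrite /k; case: (ltnP (j + m) N); lia.
have eo : wheel_opposite N (Hub false, Spoke k, true) = (Hub false, Spoke j, false).
  by apply: even_lower_opposite; rewrite // /k; case: (ltnP (j + m) N); lia.
apply: (opp _ _ _ (Hub false, Spoke k, true)) => //; last exact: edge.
by rewrite -eo (wheel_oppositeK N_gt2 wP).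
Qed.

(** Going around the upper hub from the triangle [R0], one meets the bigons
    [R_1 ... R_(m-2)], the middle bigon [C1], the bigons [L_(m-2) ... L_1] and
    the triangle [L0]. *)
Definition even_label (a : site) : letter :=
  match a with
  | Clasp => C 0
  | Hub s => if s then I else O
  | Spoke j => if j == 0 then L 0 else if j < m then R j.-1 else if j == m then C 1 else L (N - j)
  end.

Lemma even_label_inj a b a' b' : adjacent N a b -> adjacent N a' b' ->
  even_label a = even_label a' -> a = a'.
Proof.
move=> adj adj'.
have valid c d j : adjacent N c d -> c = Spoke j -> j < N.
  by move=> + ec; rewrite ec; case: d => [|s|k] //= h; lia.
case: a adj => [|[]|j] adj; case: a' adj' => [|[]|j'] adj' //=.
all: try by case: eqP => // _; case: ltnP => // _; case: eqP.
have := valid _ _ _ adj erefl; have := valid _ _ _ adj' erefl => lj' lj {adj adj'}.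
move=> h; congr Spoke; move: h.
case: (j =P 0) => j0; case: (j' =P 0) => j0'; case: (ltnP j m) => jm; case: (ltnP j' m) => jm';
  case: (j =P m) => jm2; case: (j' =P m) => jm2' //; (try case); lia.
Qed.

Lemma even_labelling : region_lettering (fun d => even_label (e d).1).
Proof. exact: (wheel_lettering N_gt2 wP even_label_inj). Qed.

Lemma even_words : [seq cycle_word even_label s | s <- even_cycles] = twist_words_even m.
Proof.
have l1 : even_label (Spoke 1) = R 0 by rewrite /= m_gt1.
have lm : even_label (Spoke m) = C 1 by rewrite /= ltnn eqxx; case: eqP => //; lia.
rewrite /even_cycles /twist_words_even !map_cat; congr (_ ++ (_ ++ _)); last first.
- rewrite -map_comp; apply/eq_in_map => i; rewrite mem_iota => li; rewrite /cycle_word /=.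
  have -> : (N - i == 0) = false by lia.
  have -> : (N - i < m) = false by lia.
  have -> : (N - i == m) = false by lia.
  by rewrite subKn //; lia.
- rewrite -map_comp; apply/eq_in_map => i; rewrite mem_iota => li; rewrite /cycle_word /=.
  by have -> : i.+1 < m by lia.
rewrite [LHS]/= /cycle_word ![map _ (even_lens _)]/= ![map _ (even_eight _)]/=.
rewrite -/(even_label (Spoke 1)) -/(even_label (Spoke m)) l1 lm.
congr [:: (_, _); _; _]; rewrite /belt !map_cons -map_comp l1; congr (_ :: _).
pose g j := even_label (Spoke (if j == N then 0 else j)).
have -> : R 0 :: map g (iota 2 N.-1) = map g (iota 1 N).
  have -> : N = N.-1.+1 by lia.
  by rewrite /= -l1 {2}/g; case: eqP => //; lia.
have -> : N = m.-1 + m by lia.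
rewrite iotaD map_cat; congr (_ ++ _).
  rewrite (iotaDl 1 0) -map_comp; apply/eq_in_map => i; rewrite mem_iota => li.
  rewrite /comp /g; case: (_ =P N) => [?|_]; first lia.
  by rewrite /= ifT //; lia.
have -> : iota (1 + m.-1) m = m :: iota m.+1 m.-1 by case: (m) m_gt1.
rewrite map_cons; congr (_ :: _); first by rewrite /g; case: (m =P N) => [?|_]; [lia|].
rewrite (@rev_map_iota _ _ N); last by lia.
have -> : N.+1 - m.-1 = m.+1 by lia.
apply/eq_in_map => i; rewrite mem_iota => li; rewrite /g.
case: (i =P N) => [->|iN]; first by rewrite subnn.
rewrite /=; have -> : (i == 0) = false by lia.
have -> : (i < m) = false by lia.
by have -> : (i == m) = false by lia.
Qed.

Lemma even_system : axis_system_is (fun d => even_label (e d).1) (twist_words_even m).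
Proof.
rewrite -even_words; apply: (wheel_axis_system N_gt2 wP).
- exact: even_labelling.
- exact: even_cyclesP.
- exact: size_even_cycles.
exact: even_covered.
Qed.

End EvenSystem.

(** ** Axes for an odd number of crossings *)

Section OddSystem.

Variables (m N : nat) (P : fourvalent_map) (e : P -> site * site).
Hypotheses (m_gt1 : 1 < m) (eN : N = m.*2) (wP : wheel N e).

Let N_gt2 : 2 < N. Proof. by lia. Qed.
Let oN : odd N = false. Proof. by lia. Qed.
Let hN : N./2 = m. Proof. by lia. Qed.

Lemma odd_hub_opposite s j k t : j < N -> k < N -> j + m = k \/ j = k + m ->
  wheel_opposite N (Hub s, Spoke j, t) = (Hub s, Spoke k, t).
Proof.
move=> lj lk jk; rewrite /wheel_opposite [region_size _ _]/= oN hN.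
by case: s; rewrite ?iter_up ?iter_down //; try lia; congr (_, Spoke _, _); case: ifP; lia.
Qed.

(** The axes, in the order of [twist_words_odd]. *)
Definition odd_cycles : seq (seq pass) :=
  [:: belt N; odd_lens m; odd_eight m]
  ++ [seq odd_pair m j | j <- iota 2 m.-1]
  ++ [seq odd_square m (N - i) | i <- iota 1 (m - 2)].

Lemma odd_cyclesP s : s \in odd_cycles -> wheel_cycle N s.
Proof.
rewrite mem_cat !inE mem_cat => /or3P[/or3P[] /eqP->|/mapP[i]|/mapP[i]].
- exact: belt_cycle.
- exact: odd_lens_cycle.
- exact: odd_eight_cycle.
- by rewrite mem_iota => li ->; apply: odd_pair_cycle; lia.
by rewrite mem_iota => li ->; apply: odd_square_cycle; lia.
Qed.

Lemma size_odd_cycles : size (flatten odd_cycles) = 4 * N + 4.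
Proof.
rewrite /odd_cycles !flatten_cat !size_cat (@size_flatten_map _ _ _ 2) //.
rewrite (@size_flatten_map _ _ _ 4) // !size_iota.
by rewrite /= size_map size_iota; lia.
Qed.

Lemma mem_odd_pair j : 1 < j <= m -> odd_pair m j \in odd_cycles.
Proof.
move=> lj; rewrite !mem_cat; apply/orP; right; apply/orP; left.
by apply/mapP; exists j; rewrite ?mem_iota //; lia.
Qed.

Lemma mem_odd_square j : m.+1 < j < N -> odd_square m j \in odd_cycles.
Proof.
move=> lj; rewrite !mem_cat; apply/orP; right; apply/orP; right.
by apply/mapP; exists (N - j); rewrite ?mem_iota ?subKn //; lia.
Qed.

Lemma odd_covered a b t : adjacent N a b -> covered N odd_cycles (a, b, t).
Proof.
have A2 c : c \in odd_lens m -> covered N odd_cycles c.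
  by apply: covered_mem; rewrite !inE eqxx orbT.
have A3 c : c \in odd_eight m -> covered N odd_cycles c.
  by apply: covered_mem; rewrite !inE eqxx !orbT.
have B j c : 1 < j <= m -> c \in odd_pair m j -> covered N odd_cycles c.
  by move=> lj; apply: covered_mem; apply: mem_odd_pair.
have D j c : m.+1 < j < N -> c \in odd_square m j -> covered N odd_cycles c.
  by move=> lj; apply: covered_mem; apply: mem_odd_square.
have opp a' b' t' c (eo : wheel_opposite N (a', b', t') = c) :=
  @covered_opposite _ _ _ N_gt2 wP odd_cycles _ _ _ _ eo.
(* Opposite passes through a hub enter at spokes that differ by [m]. *)
have shift s t' : (forall j, j < m -> covered N odd_cycles (Hub s, Spoke j, t')
     \/ covered N odd_cycles (Hub s, Spoke (j + m), t')) ->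
  forall j, j < N -> covered N odd_cycles (Hub s, Spoke j, t').
  move=> h j lj; have [ltj|lej] := ltnP j m.
    have [//|] := h j ltj; apply: opp => //; apply: odd_hub_opposite => //; lia.
  have lt : j - m < m by lia.
  have [|] := h _ lt; last by rewrite subnK.
  by apply: opp => //; apply: odd_hub_opposite; lia.
apply: (@covered_all _ _ _ N_gt2 wP _ (odd_eight m)); rewrite ?inE ?eqxx ?orbT //.
- by move=> c; rewrite !inE => /or4P[] /eqP ->; rewrite eqxx ?orbT.
- by apply: A2; rewrite !inE eqxx.
- move=> j lj; have [->|jm] := eqVneq j m; first by apply: A3; rewrite !inE eqxx !orbT.
  have [->|jm1] := eqVneq j m.+1.
    apply: (opp _ _ _ (Spoke m.+1, Hub true, true)); [by case: (m) m_gt1 => [|[|]]|rewrite /=; lia|].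
    by apply: A3; rewrite !inE eqxx !orbT.
  have [ltj|lej] := ltnP j m.
    apply: (opp _ _ _ (Spoke j, Hub true, true)); [by case: (j) lj => [|[|]]|rewrite /=; lia|].
    by apply: (D (j + m)); rewrite ?inE ?addnK ?eqxx ?orbT //; lia.
  by apply: (D j); rewrite ?inE ?eqxx //; lia.
move=> s j t'; apply: shift => {}j lj; case: s t' => [] [].
- have [->|j0] := posnP j; first by right; apply: A3; rewrite !inE eqxx !orbT.
  have [->|j1] := eqVneq j 1; first by left; apply: A3; rewrite !inE eqxx !orbT.
  by right; apply: (D (j + m)); rewrite ?inE ?eqxx ?orbT //; lia.
- have [->|j0] := posnP j.
    by right; apply: (B m); rewrite ?inE ?eqxx ?orbT //; lia.
  have [->|j1] := eqVneq j 1; first by left; apply: A2; rewrite !inE eqxx !orbT.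
  by left; apply: (B j); rewrite ?inE ?eqxx ?orbT //; lia.
- have [->|j0] := posnP j; first by left; apply: A3; rewrite !inE eqxx !orbT.
  have [->|j1] := eqVneq j 1; first by right; apply: A3; rewrite !inE eqxx !orbT.
  by left; apply: (D (j + m)); rewrite ?inE ?addnK ?eqxx ?orbT //; lia.
have [->|j0] := posnP j; first by right; apply: A2; rewrite !inE eqxx !orbT.
right; apply: (B j.+1); first lia.
by rewrite !inE (_ : j.+1 + m.-1 = j + m) ?eqxx ?orbT //; lia.
Qed.

(** Going around the upper hub from the triangle [R0], one meets
    [R_1 ... R_(m-1)], then [L_(m-1) ... L_1] and the triangle [L0]. *)
Definition odd_label (a : site) : letter :=
  match a with
  | Clasp => C 0
  | Hub s => if s then I else O
  | Spoke j => if j == 0 then L 0 else if j <= m then R j.-1 else L (N - j)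
  end.

Lemma odd_label_inj a b a' b' : adjacent N a b -> adjacent N a' b' ->
  odd_label a = odd_label a' -> a = a'.
Proof.
move=> adj adj'.
have valid c d j : adjacent N c d -> c = Spoke j -> j < N.
  by move=> + ec; rewrite ec; case: d => [|s|k] //= h; lia.
case: a adj => [|[]|j] adj; case: a' adj' => [|[]|j'] adj' //=.
all: try by case: eqP => // _; case: leqP.
have := valid _ _ _ adj erefl; have := valid _ _ _ adj' erefl => lj' lj {adj adj'}.
move=> h; congr Spoke; move: h.
case: (j =P 0) => j0; case: (j' =P 0) => j0'; case: (leqP j m) => jm; case: (leqP j' m) => jm' //;
  (try case); lia.
Qed.

Lemma odd_labelling : region_lettering (fun d => odd_label (e d).1).
Proof. exact: (wheel_lettering N_gt2 wP odd_label_inj). Qed.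

Lemma odd_words : [seq cycle_word odd_label s | s <- odd_cycles] = twist_words_odd m.
Proof.
have l1 : odd_label (Spoke 1) = R 0 by rewrite /= ltnW.
have lm : odd_label (Spoke m) = R m.-1 by rewrite /= leqnn; case: eqP => //; lia.
have lm1 : odd_label (Spoke m.+1) = L m.-1.
  by rewrite /= ltnn; congr L; lia.
rewrite /odd_cycles /twist_words_odd !map_cat; congr (_ ++ (_ ++ _)); last first.
- rewrite -map_comp; apply/eq_in_map => i; rewrite mem_iota => li; rewrite /cycle_word /=.
  have -> : (N - i == 0) = false by lia.
  have -> : (N - i <= m) = false by lia.
  have -> : (N - i - m == 0) = false by lia.
  have -> : (N - i - m <= m) by lia.
  rewrite subKn; last by lia.
  by have -> : (N - i - m).-1 = m.-1 - i by lia.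
- by rewrite -map_comp; elim: m.-1 2 => //= k IH a; rewrite IH.
rewrite [LHS]/= /cycle_word ![map _ (odd_lens _)]/= ![map _ (odd_eight _)]/=.
rewrite -/(odd_label (Spoke 1)) -/(odd_label (Spoke m)) -/(odd_label (Spoke m.+1)) l1 lm lm1.
congr [:: (_, _); _; _]; rewrite /belt !map_cons -map_comp l1; congr (_ :: _).
pose g j := odd_label (Spoke (if j == N then 0 else j)).
have -> : R 0 :: map g (iota 2 N.-1) = map g (iota 1 N).
  have -> : N = N.-1.+1 by lia.
  by rewrite /= -l1 {2}/g; case: eqP => //; lia.
have -> : N = m + m by lia.
rewrite iotaD map_cat; congr (_ ++ _).
  rewrite (iotaDl 1 0) -map_comp; apply/eq_in_map => i; rewrite mem_iota => li.
  rewrite /comp /g; case: (_ =P N) => [?|_]; first lia.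
  by rewrite /= ifT //; lia.
rewrite (@rev_map_iota _ _ N); last by lia.
have -> : N.+1 - m = 1 + m by lia.
apply/eq_in_map => i; rewrite mem_iota => li; rewrite /g.
case: eqP => [->|iN]; first by rewrite subnn.
rewrite /=.
have -> : (i == 0) = false by lia.
by have -> : (i <= m) = false by lia.
Qed.

Lemma odd_system : axis_system_is (fun d => odd_label (e d).1) (twist_words_odd m).
Proof.
rewrite -odd_words; apply: (wheel_axis_system N_gt2 wP).
- exact: odd_labelling.
- exact: odd_cyclesP.
- exact: size_odd_cycles.
exact: odd_covered.
Qed.

End OddSystem.

Lemma wheel_twist_words n (P : fourvalent_map) (e : P -> site * site) :
  3 < n -> wheel n.-1 e ->
  exists lab : P -> letter, region_lettering lab /\ axis_system_is lab (twist_words n).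
Proof.
move=> n3 wP; rewrite /twist_words; case: ifP => on.
  have h1 : 1 < n./2 by lia.
  have h2 : n.-1 = n./2.*2 by lia.
  by eexists; split; [apply: (odd_labelling h1 h2 wP)|apply: odd_system].
have h1 : 1 < n./2 by lia.
have h2 : n.-1 = n./2.*2.-1 by lia.
by eexists; split; [apply: (even_labelling h1 h2 wP)|apply: even_system].
Qed.

(** * Recognizing a wheel from its dual graph *)

Section Recognition.

Variables (N : nat) (P : fourvalent_map) (e : P -> site * site).
Hypothesis N_gt2 : 2 < N.
Hypothesis card_P : #|P| = 4 * N + 4.
Hypothesis e_ex : forall a b, adjacent N a b -> exists d, e d = (a, b).
Hypothesis e_edge : forall d, e (edge d) = swap (e d).
Hypothesis e_region : forall d d', (e d).1 = (e d').1 <-> fconnect (@face P) d d'.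

Let e_inj : injective e. Proof. by case: (arcs_count card_P e_ex). Qed.
Let e_adj d : adjacent N (e d).1 (e d).2. Proof. by case: (arcs_count card_P e_ex). Qed.

(** The neighbour of [a] that follows [b] around [a], with junk value [b] when
    no dart has coordinates [(a, b)]. *)
Let next (a b : site) : site :=
  if [pick d | e d == (a, b)] is Some d then (e (face d)).2 else b.

Let e_face d : e (face d) = ((e d).1, next (e d).1 (e d).2).
Proof.
have -> : (e d).1 = (e (face d)).1 by apply/e_region/fconnect1.
rewrite [LHS]surjective_pairing; congr (_, _); rewrite /next.
have <- : (e d).1 = (e (face d)).1 by apply/e_region/fconnect1.
case: pickP => [d' /eqP|/(_ d)]; last by rewrite -surjective_pairing eqxx.
by rewrite -surjective_pairing => /e_inj ->.
Qed.

Let next_adj a b : adjacent N a b -> adjacent N a (next a b).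
Proof. by case/e_ex=> d ed; have := e_adj (face d); rewrite e_face ed. Qed.

Let next_inj a b b' : next a b = next a b' -> adjacent N a b -> adjacent N a b' -> b = b'.
Proof.
move=> eb /e_ex[d ed] /e_ex[d' ed'].
have : face d = face d' by apply: e_inj; rewrite !e_face ed ed' /= eb.
by move/face_inj => dd'; move: ed'; rewrite -dd' ed => -[].
Qed.

Let e_iter_face k d : e (iter k (@face P) d) = ((e d).1, iter k (next (e d).1) (e d).2).
Proof.
elim: k => [|k IH]; first exact: surjective_pairing.
by rewrite iterS e_face IH.
Qed.

Let next_reach a b b' : adjacent N a b -> adjacent N a b' -> exists k, iter k (next a) b = b'.
Proof.
move=> /e_ex[d ed] /e_ex[d' ed'].
have /iter_findex edd' : fconnect (@face P) d d' by apply/e_region; rewrite ed ed'.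
exists (findex (@face P) d d').
by have := e_iter_face (findex (@face P) d d') d; rewrite edd' ed ed' => -[].
Qed.

(** Around a crossing the boundary walks close up after four corners: if [c]
    follows [a] around [b] and [d] follows [b] around [c], then [a] follows [c]
    around [d] and [b] follows [d] around [a]. *)
Let next_crossing a b : adjacent N a b ->
  let c := next b a in let d := next c b in next d c = a /\ next a d = b.
Proof.
case/e_ex=> x ex /=.
pose f (y : P) := face (edge y).
have ef y : e (f y) = ((e y).2, next (e y).2 (e y).1) by rewrite e_face e_edge.
have nf y : node (f y) = y by rewrite /f node_face edgeK.
have f4 : f (f (f (f x))) = x.
  have n4 z : iter 4 (@node P) z = z by rewrite -(node4 z) iter_order //; apply: node_inj.
  by rewrite -[LHS]n4 /= !nf.
by move: (congr1 e f4); rewrite !ef ex /= => -[ea]; rewrite ea.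
Qed.

(** A region with at least two neighbours is not adjacent to the same one twice
    in a row. *)
Let fixed_absurd a b b' : adjacent N a b -> adjacent N a b' -> b != b' -> next a b != b.
Proof.
move=> ab ab' bb'; apply/eqP => eb; case/eqP: bb'.
by have [k <-] := next_reach ab ab'; elim: k => //= k <-.
Qed.

Let next_bigon j s : 1 < j < N -> next (Spoke j) (Hub s) = Hub (~~ s).
Proof.
move=> lj; have [j1 jN] := andP lj.
have := next_adj (a := Spoke j) (b := Hub s) jN.
have : next (Spoke j) (Hub s) != Hub s by apply: (fixed_absurd (b' := Hub (~~ s))) => //; case: s.
by case: (next _ _) => [|u|//] /=; [lia|case: s u => [] []].
Qed.

Let next_clasp j : j < 2 -> next Clasp (Spoke j) = Spoke (1 - j).
Proof.
move=> lj; have := next_adj (a := Clasp) (b := Spoke j) lj.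
have : next Clasp (Spoke j) != Spoke j.
  apply: (fixed_absurd (b' := Spoke (1 - j))); rewrite /=; try lia.
  by apply/eqP => -[]; lia.
case: (next _ _) => [//|//|k] /= kj lk; congr Spoke; move/eqP: kj => kj.
by case: (k =P j) kj => [->//|? _]; lia.
Qed.

(** The hub that follows the clasp around [Spoke 0]; it will be the upper one. *)
Let s := if next (Spoke 0) Clasp is Hub u then u else true.

Let next0C : next (Spoke 0) Clasp = Hub s.
Proof.
rewrite /s; have := next_adj (a := Spoke 0) (b := Clasp) isT.
have : next (Spoke 0) Clasp != Clasp.
  by apply: (fixed_absurd (b' := Hub true)) => //; apply: ltnW (ltnW _).
by case: (next _ _).
Qed.

Let N_gt0 : 0 < N. Proof. exact: ltnW (ltnW N_gt2). Qed.
Let N_gt1 : 1 < N. Proof. exact: ltnW N_gt2. Qed.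

Let next0s : next (Spoke 0) (Hub s) = Hub (~~ s).
Proof.
have := next_adj (a := Spoke 0) (b := Hub s) N_gt0.
have ne : next (Spoke 0) (Hub s) != Hub s by apply: (fixed_absurd (b' := Clasp)).
have [k] := next_reach (a := Spoke 0) (b := Clasp) (b' := Hub (~~ s)) isT N_gt0.
case E: (next (Spoke 0) (Hub s)) ne => [|u|//] ne; last by case: (s) u ne {E} => [] [].
have -> : iter k (next (Spoke 0)) Clasp = if odd k then Hub s else Clasp.
  by elim: k => //= k ->; case: odd => //=.
by case: odd => //; case: s => -[].
Qed.

Let next0ns : next (Spoke 0) (Hub (~~ s)) = Clasp.
Proof.
have := next_adj (a := Spoke 0) (b := Hub (~~ s)) N_gt0.
case E: (next (Spoke 0) (Hub (~~ s))) => [|u|//] // _.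
have [us|us] := eqVneq u s.
  by rewrite us -next0C in E; have := next_inj E N_gt0 isT.
have us' : u = ~~ s by case: (u) (s) us => [] [].
by rewrite us' -[RHS]next0s in E; have := next_inj E N_gt0 N_gt0; case: s => -[].
Qed.

(** The crossing where the clasp, [Spoke 0] and [Hub s] meet has [Spoke 1] as its
    fourth corner. *)
Let next_s0 : next (Hub s) (Spoke 0) = Spoke 1 /\ next (Spoke 1) (Hub s) = Clasp.
Proof.
have [] := next_crossing (a := Clasp) (b := Spoke 0) isT; rewrite next0C.
have := next_adj (a := Hub s) (b := Spoke 0) N_gt0.
case: (next (Hub s) (Spoke 0)) => [//|//|j] /= lj ej _.
have := next_adj (a := Spoke j) (b := Hub s) lj; rewrite ej /=.
by case: j lj ej => [|[|//]] // _; rewrite ?next0s.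
Qed.

(** At the other crossing of the clasp, the fourth corner is [Hub (~~ s)]. *)
Let next1C : next (Spoke 1) Clasp = Hub (~~ s) /\ next (Hub (~~ s)) (Spoke 1) = Spoke 0.
Proof.
have [] := next_crossing (a := Spoke 0) (b := Clasp) isT; rewrite (next_clasp (j := 0)) //=.
have := next_adj (a := Spoke 1) (b := Clasp) isT.
case E: (next (Spoke 1) Clasp) => [|u|//] /= _.
  by rewrite (next_clasp (j := 1)) // => _; rewrite next0C.
move=> eu; have [us|us] := eqVneq u s; first by rewrite us next0s.
have us' : u = ~~ s by case: (u) (s) us => [] [].
by rewrite us' in eu *.
Qed.

Let next1ns : next (Spoke 1) (Hub (~~ s)) = Hub s.
Proof.
have := next_adj (a := Spoke 1) (b := Hub (~~ s)) N_gt1.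
case E: (next (Spoke 1) (Hub (~~ s))) => [|u|//] // _.
  by rewrite -next_s0.2 in E; have := next_inj E N_gt1 N_gt1; case: s => -[].
have [-> //|us] := eqVneq u s.
have us' : u = ~~ s by case: (u) (s) us => [] [].
by rewrite us' -[RHS]next1C.1 in E; have := next_inj E N_gt1 isT.
Qed.

(** The two hubs meet the spokes in opposite cyclic orders: at the crossing of
    [Hub s] between two consecutive spokes, the fourth corner is the other hub,
    unless it is the clasp and [next1C] applies. *)
Let next_inverse j : j < N -> next (Hub (~~ s)) (next (Hub s) (Spoke j)) = Spoke j.
Proof.
move=> lj; have [] := next_crossing (a := Spoke j) (b := Hub s) lj.
have := next_adj (a := Hub s) (b := Spoke j) lj.
case E: (next (Hub s) (Spoke j)) => [//|//|k] /= lk.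
case: k E lk => [|[|k]] E lk.
- by rewrite next0s.
- rewrite -next_s0.1 in E; have [->] := next_inj E lj N_gt0.
  by rewrite next1C.2.
by rewrite next_bigon.
Qed.

(** The spokes in the order of the walk around [Hub s]. *)
Let S := traject (next (Hub s)) (Spoke 0) N.

Let S_spec : [/\ uniq S, forall x, (x \in S) = adjacent N (Hub s) x
  & iter N (next (Hub s)) (Spoke 0) = Spoke 0].
Proof.
have [q eqq] := e_ex (a := Hub s) (b := Spoke 0) N_gt0.
pose o := order (@face P) q.
have tr : [seq (e y).2 | y <- orbit (@face P) q] = traject (next (Hub s)) (Spoke 0) o.
  apply: (@eq_from_nth _ (Spoke 0)); rewrite size_map size_orbit ?size_traject // => i lio.
  rewrite (nth_map q) ?size_orbit // (nth_traject (next (Hub s)) lio) /orbit.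
  by rewrite (nth_traject (@face P) lio) e_iter_face eqq.
have inj2 : {in orbit (@face P) q &, injective (fun y => (e y).2)}.
  move=> y z; rewrite -!fconnect_orbit => /e_region qy /e_region qz yz.
  by apply: e_inj; rewrite [e y]surjective_pairing [e z]surjective_pairing -qy qz yz.
have mem x : (x \in traject (next (Hub s)) (Spoke 0) o) = adjacent N (Hub s) x.
  rewrite -tr; apply/mapP/idP => [[y]|/e_ex[y ey]].
    by rewrite -fconnect_orbit => /e_region; rewrite eqq => es ->; have := e_adj y; rewrite -es.
  by exists y; rewrite ?ey // -fconnect_orbit; apply/e_region; rewrite eqq ey.
have un : uniq (traject (next (Hub s)) (Spoke 0) o).
  by rewrite -tr map_inj_in_uniq ?orbit_uniq.
have oN : o = N.
  rewrite -(size_traject (next (Hub s)) (Spoke 0) o) -(size_iota 0 N) -(size_map Spoke).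
  apply/perm_size/uniq_perm => //; first by rewrite map_inj_uniq ?iota_uniq // => i j [].
  move=> x; rewrite mem; apply/idP/mapP => [|[j]]; last by rewrite mem_iota => lj ->.
  by case: x => // j lj; exists j => //; rewrite mem_iota.
rewrite oN in un mem; split=> //.
by have := e_iter_face o q; rewrite (iter_order (@face_inj P)) eqq oN => /(congr1 snd) /= <-.
Qed.

(** The new number of [Spoke j]. *)
Let pos (j : nat) := index (Spoke j) S.

Let pos_lt j : j < N -> pos j < N.
Proof.
case: S_spec => _ mem _ lj.
by have := mem (Spoke j); rewrite -index_mem size_traject /= lj.
Qed.

Let pos_inj i j : i < N -> j < N -> pos i = pos j -> i = j.
Proof.
case: S_spec => _ mem _ li lj ij.
have : nth Clasp S (pos i) = nth Clasp S (pos j) by rewrite ij.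
by rewrite !nth_index ?mem // => -[].
Qed.

Let pos_surj k : k < N -> exists2 j, j < N & pos j = k.
Proof.
case: S_spec => un mem _ lk.
have sk : k < size S by rewrite size_traject.
have := mem_nth Clasp sk; rewrite mem; case E: (nth _ _ _) => [//|//|j] /= lj.
by exists j; rewrite // /pos -E index_uniq.
Qed.

Let pos_next j : j < N ->
  exists2 k, k < N & next (Hub s) (Spoke j) = Spoke k /\ pos k = up N (pos j).
Proof.
move=> lj; have := next_adj (a := Hub s) (b := Spoke j) lj.
case E: (next _ _) => [//|//|k] /= lk; exists k => //; split=> //.
case: S_spec => un mem itN; have lp := pos_lt lj.
have ej : iter (pos j) (next (Hub s)) (Spoke 0) = Spoke j.
  by rewrite -(nth_traject _ lp) nth_index // mem.
have ek : iter (pos j).+1 (next (Hub s)) (Spoke 0) = Spoke k by rewrite iterS ej.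
rewrite /up; case: eqP => pN.
  by rewrite pN itN in ek; rewrite /pos -ek /S; case: (N) N_gt0 => //= n _; rewrite eqxx.
rewrite /pos -ek -(@nth_traject _ _ _ N) ?index_uniq ?size_traject //; lia.
Qed.

Let pos0 : pos 0 = 0.
Proof. by rewrite /pos /S; case: (N) N_gt0 => //= n _; rewrite eqxx. Qed.

Let pos1 : pos 1 = 1.
Proof.
have [k _ []] := pos_next N_gt0; rewrite next_s0.1 => -[<-] ->.
by rewrite pos0 up0.
Qed.

Let relabel (a : site) : site :=
  match a with Clasp => Clasp | Hub u => Hub (u == s) | Spoke j => Spoke (pos j) end.

Let relabel_next a b : adjacent N a b -> relabel (next a b) = turn N (relabel a) (relabel b).
Proof.
case: a => [|u|[|[|j]]]; case: b => [//|t|k] //= lk.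
- by rewrite next_clasp //=; case: k lk => [|[|//]] _; rewrite /= ?pos0 ?pos1.
- have [->|us] := eqVneq u s.
    by have [k' _ [-> /= ->]] := pos_next lk.
  have -> : u = ~~ s by case: (u) (s) us => [] [].
  have [i li [ei pi]] : exists2 i, i < N & next (Hub s) (Spoke i) = Spoke k /\ up N (pos i) = pos k.
    have [p lp] : exists2 p, p < N & up N p = pos k.
      exists (down N (pos k)); have := pos_lt lk; rewrite /down /up; first by case: eqP; lia.
      by case: (pos k =P 0) => p0; case: eqP; lia.
    have [i li <-] := pos_surj lp; exists i => //.
    have [k' lk' [-> ek']] := pos_next li; split=> //; congr Spoke; apply: pos_inj => //.
    by rewrite ek'.
  rewrite -ei next_inverse //= -pi; congr Spoke.
  have := pos_lt li; rewrite /down /up; case: (_ =P N) => /=; lia.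
- by rewrite next0C pos0 /= eqxx.
- rewrite pos0; have [->|ts] := eqVneq t s.
    by rewrite next0s /= (negbTE (_ : ~~ s != s)) //; case: s.
  have -> : t = ~~ s by case: (t) (s) ts => [] [].
  by rewrite next0ns.
- by rewrite next1C.1 pos1 /=; congr Hub; case: s.
- rewrite pos1; have [->|ts] := eqVneq t s; first by rewrite next_s0.2.
  have -> : t = ~~ s by case: (t) (s) ts => [] [].
  by rewrite next1ns /= eqxx.
rewrite next_bigon //=.
have : 1 < pos j.+2.
  rewrite ltnNge; apply/negP => p1.
  case E: (pos j.+2) p1 => [|[|//]] _; first by have := pos_inj lk N_gt0; rewrite pos0 => /(_ E).
  by have := pos_inj lk N_gt1; rewrite pos1 => /(_ E).
case: (pos _) => [|[|p]] // _; congr Hub; by case: t s => [] [].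
Qed.

(** A map with the dual graph of a wheel is a wheel, for a suitable numbering of
    the spokes and a suitable choice of the upper hub. *)
Lemma wheel_recognition : exists e' : P -> site * site, wheel N e'.
Proof.
pose e' d := (relabel (e d).1, relabel (e d).2).
have ex' a b : adjacent N a b -> exists d, e' d = (a, b).
  have lift a' b' : adjacent N a' b' -> exists d, e' d = (relabel a', relabel b').
    by case/e_ex=> d ed; exists d; rewrite /e' ed.
  have hub u : relabel (Hub (u == s)) = Hub u by rewrite /=; congr Hub; case: u s => [] [].
  case: a b => [|u|j] [|t|k] //= lk.
  - have <- : (pos k = k) by case: k lk => [|[|//]].
    exact: (lift Clasp (Spoke k)).
  - have [i li <-] := pos_surj lk; rewrite -hub; exact: (lift (Hub _) (Spoke i)).
  - have <- : (pos j = j) by case: j lk => [|[|//]].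
    exact: (lift (Spoke j) Clasp).
  have [i li <-] := pos_surj lk; rewrite -hub; exact: (lift (Spoke i) (Hub _)).
have [inj' adj'] := arcs_count card_P ex'.
exists e'; split=> //.
- move=> a b; split=> [|[d ed]]; first exact: ex'.
  by have := adj' d; rewrite ed.
- by move=> d; rewrite /e' e_edge.
by move=> d; rewrite /e' e_face /= relabel_next.
Qed.

End Recognition.

(** * Letters of the twist words *)

(** Generalizes counts and equality tests of letters, for [lia]. *)
Ltac gen_count := repeat match goal with
  | |- context [count ?a ?s] => move: (count a s) => ?
  | |- context [@eq_op letter ?a ?b] => move: (a == b : nat) => ?
  end.

Lemma count_R A s : count_mem A [seq R i | i <- s] = if A is R i then count_mem i s else 0.
Proof.
rewrite count_map; case: A => [i|i|i||]; try by apply/eqP; rewrite -leqn0 leqNgt -has_count; apply/hasPn.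
by apply: eq_count => j; apply/eqP/eqP => [[]|->].
Qed.

Lemma count_L A s : count_mem A [seq L i | i <- s] = if A is L i then count_mem i s else 0.
Proof.
rewrite count_map; case: A => [i|i|i||]; try by apply/eqP; rewrite -leqn0 leqNgt -has_count; apply/hasPn.
by apply: eq_count => j; apply/eqP/eqP => [[]|->].
Qed.

Lemma count_iota i a k : count_mem i (iota a k) = (a <= i < a + k).
Proof. by rewrite count_uniq_mem ?iota_uniq // mem_iota. Qed.

Lemma count_subn i m : count_mem i [seq m.-1 - j | j <- iota 1 (m - 2)] = (0 < i < m.-1).
Proof.
rewrite count_uniq_mem; last first.
  by rewrite map_inj_in_uniq ?iota_uniq // => j k; rewrite !mem_iota; lia.
congr nat_of_bool; apply/mapP/idP => [[j]|li]; first by rewrite mem_iota; lia.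
by exists (m.-1 - i); rewrite ?mem_iota; lia.
Qed.

Lemma text_cat (T : Type) (u v : seq (word T)) : text (u ++ v) = text u ++ text v.
Proof. by rewrite /text map_cat flatten_cat. Qed.

Lemma count_text3 A (g : nat -> letter) s :
  count_mem A (text [seq (true, [:: g i; I; O]) | i <- s])
  = count_mem A [seq g i | i <- s] + ((I == A) + (O == A)) * size s.
Proof. by elim: s => [|i s IH]; rewrite /= ?muln0 // -/(text _) IH mulnS; gen_count; lia. Qed.

Lemma count_text4 A (g h : nat -> letter) s :
  count_mem A (text [seq (true, [:: g i; I; h i; O]) | i <- s])
  = count_mem A [seq g i | i <- s] + count_mem A [seq h i | i <- s]
    + ((I == A) + (O == A)) * size s.
Proof. by elim: s => [|i s IH]; rewrite /= ?muln0 // -/(text _) IH mulnS; gen_count; lia. Qed.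

Lemma count_textIO A k :
  count_mem A (text (nseq k (false, [:: I; O]))) = ((I == A) + (O == A)) * k.
Proof. by elim: k => [|k IH]; rewrite /= ?muln0 // -/(text _) IH mulnS; gen_count; lia. Qed.

Lemma count_even_words A m : count_mem A (text (twist_words_even m)) =
  count_mem A [:: C 0; C 1; C 0; I; C 1; O; L 0; R 0; I; O; R 0; L 0; O; I]
  + count_mem A [seq R i | i <- iota 0 m.-1] + count_mem A [seq L i | i <- iota 0 m.-1]
  + count_mem A [seq R i | i <- iota 1 (m - 2)] + count_mem A [seq L i | i <- iota 1 (m - 2)]
  + ((I == A) + (O == A)) * (m - 2).*2.
Proof.
rewrite /twist_words_even !text_cat !count_cat !count_text3 size_iota.
rewrite /text /= !count_cat /= count_rev; gen_count; lia.
Qed.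

Lemma count_odd_words A m : count_mem A (text (twist_words_odd m)) =
  count_mem A [:: C 0; C 0; I; O; L 0; R 0; I; L m.-1; O; R 0; L 0; O; R m.-1; I]
  + count_mem A [seq R i | i <- iota 0 m] + count_mem A [seq L i | i <- iota 0 m]
  + count_mem A [seq R (m.-1 - i) | i <- iota 1 (m - 2)]
  + count_mem A [seq L i | i <- iota 1 (m - 2)]
  + ((I == A) + (O == A)) * (m.-1 + (m - 2)).
Proof.
rewrite /twist_words_odd !text_cat !count_cat count_text4 count_textIO size_iota.
rewrite /text /= !count_cat /= count_rev; gen_count; lia.
Qed.

(** The odd letters of [twist_words n]. *)
Definition odd_sided n (A : letter) : bool :=
  match A with R 0 | L 0 => true | I | O => ~~ odd n | _ => false end.

Lemma odd_count_twist n A : 3 < n -> odd (count_mem A (text (twist_words n))) = odd_sided n A.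
Proof.
have eqC i j : (C i == C j) = (i == j) by apply/eqP/eqP => [[]|->].
have eqR i j : (R i == R j) = (i == j) by apply/eqP/eqP => [[]|->].
have eqL i j : (L i == L j) = (i == j) by apply/eqP/eqP => [[]|->].
move=> n3; rewrite /twist_words; case: ifP => on.
  have m1 : 1 < n./2 by lia.
  move: (n./2) m1 => m m1; rewrite count_odd_words.
  have -> : [seq R (m.-1 - i) | i <- iota 1 (m - 2)]
          = [seq R i | i <- [seq m.-1 - j | j <- iota 1 (m - 2)]].
    by rewrite -map_comp.
  rewrite !count_R !count_L.
  case: A => [i|i|i||]; rewrite /= ?count_iota ?count_subn ?on /=; rewrite ?eqC ?eqR ?eqL ?mul0n.
  - lia.
  - case: i => [|i]; lia.
  - case: i => [|i]; lia.
  - lia.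
  - lia.
have m1 : 1 < n./2 by lia.
move: (n./2) m1 => m m1; rewrite count_even_words !count_R !count_L.
case: A => [i|i|i||]; rewrite /= ?count_iota ?on /=; rewrite ?eqC ?eqR ?eqL ?mul0n.
- case: i => [|[|i]]; lia.
- case: i => [|i]; lia.
- case: i => [|i]; lia.
- lia.
- lia.
Qed.

Lemma size_twist_words n : 3 < n -> size (text (twist_words n)) = 4 * n.
Proof.
move=> n3; have sz3 g s : size (text [seq (true, [:: g i; I; O]) | i <- s] : seq letter) = 3 * size s.
  by elim: s => //= i s IH; rewrite -/(text _) IH mulnS.
have sz4 g h s : size (text [seq (true, [:: g i; I; h i; O]) | i <- s] : seq letter) = 4 * size s.
  by elim: s => //= i s IH; rewrite -/(text _) IH mulnS.
have sz2 k : size (text (nseq k (false, [:: I; O]))) = 2 * k.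
  by elim: k => //= k IH; rewrite -/(text _) IH mulnS.
rewrite /twist_words; case: ifP => on.
  rewrite /twist_words_odd !text_cat !size_cat sz2 sz4 size_iota.
  by rewrite /text /= !size_cat /= size_rev !size_map !size_iota; lia.
rewrite /twist_words_even !text_cat !size_cat !sz3 size_iota.
by rewrite /text /= !size_cat /= size_rev !size_map !size_iota; lia.
Qed.

(** * Reading the dual graph off the axis words *)

Section Reading.

Variables (P : fourvalent_map) (lab : P -> letter) (n : nat).
Hypotheses (n_gt3 : 3 < n) (lettering : region_lettering lab).
Hypothesis system : axis_system_is lab (twist_words n).

Lemma twist_card : #|P| = 4 * n.-1 + 4.
Proof.
have [starts pe ew] := (axis_system_starts lettering _).1 system.
rewrite (card_darts lab pe) ew size_twist_words //; lia.
Qed.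

Lemma twist_odd_letter A : odd_letter lab A = odd_sided n A.
Proof.
have [starts pe ew] := (axis_system_starts lettering _).1 system.
by rewrite (odd_letter_count lettering pe) ew odd_count_twist.
Qed.

(** [w] is read along some axis, from some starting point. *)
Definition is_axis_word (w : word letter) : Prop := exists x : item P, axis_word lab x = w.

Lemma twist_axis_word w : w \in twist_words n -> is_axis_word w.
Proof.
have [starts pe <-] := (axis_system_starts lettering _).1 system.
by case/mapP => x _ ->; exists x.
Qed.

Lemma sigma_is_axis_word w : is_axis_word w -> is_axis_word (sigma (odd_sided n) w).
Proof.
case=> x <-; exists (step x); rewrite -sigma_axis_word //.
by rewrite /sigma; case: (_.2) => // A s; rewrite twist_odd_letter.
Qed.

(** The regions [A] and [B] lie on both sides of some edge. *)
Definition linked A B : Prop := exists d : P, lab d = A /\ lab (edge d) = B.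

Lemma linkedC A B : linked A B -> linked B A.
Proof. by case=> d [? ?]; exists (edge d); rewrite edgeK. Qed.

(** With sign -, the travel starts on the edge between the last region and the
    first one. *)
Lemma axis_word_linked A s : is_axis_word (true, A :: s) -> linked A (last A s).
Proof.
case=> x ex; exists x.1.
have [ex2 eA] : x.2 = true /\ lab x.1 = A.
  by move: ex; rewrite /axis_word orbit_cons => -[? ?].
split=> //; pose y := opposite (across x).
have ey : step y = x by rewrite /y step_opposite acrossK.
have eyl : lab y.1 = lab (edge x.1) by rewrite /y lab_opposite // /across ex2.
have := sigma_axis_word lettering y; rewrite ey ex.
rewrite /axis_word orbit_cons /sigma /= => -[_] /(congr1 (last A)).
by rewrite last_rcons eyl.
Qed.

(** The same after [k] cyclic permutations, when the sign is then -. *)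
Lemma read_link k w A : is_axis_word w -> let w' := iter k (sigma (odd_sided n)) w in
  w'.1 -> w'.2 != [::] -> linked (head A w'.2) (last A w'.2).
Proof.
move=> aw /=; have : is_axis_word (iter k (sigma (odd_sided n)) w).
  by elim: k => //= k; apply: sigma_is_axis_word.
by case: (iter _ _ _) => [[] [|B s]] //= /axis_word_linked.
Qed.

(** The twist words contain all adjacencies of a wheel. *)
Lemma twist_links : exists l : site -> letter,
  (forall a b a' b', adjacent n.-1 a b -> adjacent n.-1 a' b' -> l a = l a' -> a = a')
  /\ forall a b, adjacent n.-1 a b -> linked (l a) (l b).
Proof.
suff [l [linj C0 C1 H]] : exists l : site -> letter,
    [/\ forall a b a' b', adjacent n.-1 a b -> adjacent n.-1 a' b' -> l a = l a' -> a = a',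
     linked (l Clasp) (l (Spoke 0)), linked (l Clasp) (l (Spoke 1))
   & forall s j, j < n.-1 -> linked (l (Hub s)) (l (Spoke j))].
  exists l; split=> // -[|s|j] [|t|k] //= h; try exact: H; try (apply: linkedC; exact: H).
    by case: k h => [|[|]].
  by apply: linkedC; case: j h => [|[|]].
have tw := twist_axis_word; rewrite /twist_words in tw.
case on: (odd n) tw => tw.
  have m1 : 1 < n./2 by lia.
  have eN : n.-1 = n./2.*2 by lia.
  move: (n./2) m1 eN tw => m m1 eN tw.
  have [w1 w3] :
      is_axis_word (true, C 0 :: [seq R i | i <- iota 0 m] ++ rev [seq L i | i <- iota 0 m])
    /\ is_axis_word (true, [:: L 0; R 0; I; L m.-1; O; R 0; L 0; O; R m.-1; I]).
    by split; apply: tw; rewrite mem_cat !inE eqxx ?orbT.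
  have wLR i : 0 < i < m.-1 -> is_axis_word (true, [:: L i; I; R (m.-1 - i); O]).
    move=> li; apply: tw; rewrite !mem_cat; apply/orP; right; apply/orP; right.
    by apply/mapP; exists i; rewrite // mem_iota; lia.
  have m0 : 0 < m.-1 by lia.
  have em : m = m.-1.+1 by lia.
  exists (odd_label m n.-1); split.
  - exact: odd_label_inj.
  - have := read_link (k := 0) (C 0) w1 isT isT; rewrite /= last_cat em /=.
    by rewrite rev_cons last_rcons.
  - have := read_link (k := 1) (C 0) w1; rewrite em /= last_rcons.
    by move=> /(_ isT isT) /linkedC.
  have [k ek] : exists k, m.-1 = k.+1 by exists m.-2; lia.
  rewrite ek in w3.
  have bigonR i : 0 < i < m -> linked I (R i) /\ linked O (R i).
    move=> li; have [->|im] := eqVneq i m.-1.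
      rewrite ek; split; last by apply: linkedC; have := read_link (k := 8) I w3; rewrite /= ?on; apply.
      by have := read_link (k := 9) I w3; rewrite /= ?on; apply.
    have wi : 0 < m.-1 - i < m.-1 by lia.
    have := wLR _ wi; rewrite subKn; last by lia.
    case: (m.-1 - i) wi => // p _; case: i li im => // i _ _ w4.
    split; last by have := read_link (k := 3) I w4; rewrite /= ?on; apply.
    by apply: linkedC; have := read_link (k := 2) I w4; rewrite /= ?on; apply.
  have bigonL i : 0 < i < m -> linked I (L i) /\ linked O (L i).
    move=> li; have [->|im] := eqVneq i m.-1.
      rewrite ek; split; first by apply: linkedC; have := read_link (k := 3) I w3; rewrite /= ?on; apply.
      by have := read_link (k := 4) I w3; rewrite /= ?on; apply.
    have wi : 0 < i < m.-1 by lia.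
    have := wLR _ wi; case: i li im wi => // i _ _ wi w4.
    split; last exact/linkedC/(read_link (k := 0) I w4).
    by have := read_link (k := 1) I w4; rewrite /= ?on; apply.
  move=> s j lj; have [j0|j0] := posnP j.
    rewrite j0; case: s => /=; first exact/linkedC/(read_link (k := 0) I w3).
    by have := read_link (k := 7) I w3; rewrite /= ?on; apply.
  have [j1|j1] := eqVneq j 1.
    rewrite j1 /= ltnW //; case: s; first by have := read_link (k := 2) I w3; rewrite /= ?on; apply.
    by apply: linkedC; have := read_link (k := 5) I w3; rewrite /= ?on; apply.
  suff [] : linked I (odd_label m n.-1 (Spoke j)) /\ linked O (odd_label m n.-1 (Spoke j)) by case: s.
  rewrite /=; have -> : (j == 0) = false by lia.
  case: (leqP j m) => jm2; [apply: bigonR|apply: bigonL]; lia.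
have m1 : 1 < n./2 by lia.
have eN : n.-1 = n./2.*2.-1 by lia.
move: (n./2) m1 eN tw => m m1 eN tw.
have [w1 w2 w3] : [/\ is_axis_word (true, C 0 :: [seq R i | i <- iota 0 m.-1]
             ++ C 1 :: rev [seq L i | i <- iota 0 m.-1]),
    is_axis_word (false, [:: C 0; I; C 1; O])
  & is_axis_word (true, [:: L 0; R 0; I; O; R 0; L 0; O; I])].
  by split; apply: tw; rewrite mem_cat !inE eqxx ?orbT.
have em : m.-1 = (m - 2).+1 by lia.
have wR i : 0 < i < m.-1 -> is_axis_word (true, [:: R i; I; O]).
  move=> li; apply: tw; rewrite !mem_cat; apply/orP; right; apply/orP; left.
  by apply/mapP; exists i; rewrite // mem_iota; lia.
have wL i : 0 < i < m.-1 -> is_axis_word (true, [:: L i; I; O]).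
  move=> li; apply: tw; rewrite !mem_cat; apply/orP; right; apply/orP; right.
  by apply/mapP; exists i; rewrite // mem_iota; lia.
exists (even_label m n.-1); split.
- exact: even_label_inj.
- have := read_link (k := 0) (C 0) w1 isT isT; rewrite /= last_cat /= em /=.
  by rewrite rev_cons last_rcons.
- have := read_link (k := 1) (C 0) w1; rewrite em /= last_rcons m1.
  by move=> /(_ isT isT) /linkedC.
(* A bigon is read between the hubs in a word of three letters. *)
have bigon A : odd_sided n A = false -> is_axis_word (true, [:: A; I; O]) ->
    linked I A /\ linked O A.
  move=> oA wA; split.
    by have := read_link (k := 1) A wA; rewrite /= oA; apply.
  exact/linkedC/(read_link (k := 0) A wA).
move=> s j lj; have [j0|j0] := posnP j.
  rewrite j0; case: s => /=; first exact/linkedC/(read_link (k := 0) I w3).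
  by have := read_link (k := 6) I w3; rewrite /= ?on; apply.
have [j1|j1] := eqVneq j 1.
  rewrite j1 /= m1; case: s; first by have := read_link (k := 2) I w3; rewrite /= ?on; apply.
  by apply: linkedC; have := read_link (k := 4) I w3; rewrite /= ?on; apply.
have [jm|jm] := eqVneq j m.
  have -> : even_label m n.-1 (Spoke j) = C 1.
    by rewrite /= jm ltnn eqxx; case: eqP => //; lia.
  case: s; last by have := read_link (k := 3) I w2; rewrite /= ?on; apply.
  by apply: linkedC; have := read_link (k := 2) I w2; rewrite /= ?on; apply.
suff [] : linked I (even_label m n.-1 (Spoke j)) /\ linked O (even_label m n.-1 (Spoke j)) by case: s.
rewrite /= (negbTE jm); have -> : (j == 0) = false by lia.
case: (ltnP j m) => jm2; apply: bigon.
- by case: j j0 j1 {lj jm jm2} => [|[|j]].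
- by apply: wR; lia.
- by have : 0 < n.-1 - j; [lia | case: (n.-1 - j)].
by apply: wL; lia.
Qed.

(** The regions of the wheel with [N] spokes. *)
Definition sites N : seq site := [:: Clasp, Hub true, Hub false & [seq Spoke j | j <- iota 0 N]].

Lemma twist_wheel_of_words : exists e : P -> site * site, wheel n.-1 e.
Proof.
have [l [l_inj links]] := twist_links; set N := n.-1 in l_inj links.
have N2 : 2 < N by rewrite /N; lia.
pose unl A := nth Clasp (sites N) (index A [seq l a | a <- sites N]).
have mem_sites a b : adjacent N a b -> a \in sites N.
  case: a => [|[]|j]; rewrite ?inE ?eqxx ?orbT // => h.
  apply/orP; right; apply/orP; right; apply/orP; right; apply/map_f; rewrite mem_iota.
  by case: b h => [|s|k] //= h; lia.
have sites_adj a : a \in sites N -> exists b, adjacent N a b.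
  rewrite !inE => /or4P[/eqP->|/eqP->|/eqP->|/mapP[j + ->]].
  - by exists (Spoke 0).
  - by exists (Spoke 0) => /=; lia.
  - by exists (Spoke 0) => /=; lia.
  by rewrite mem_iota; exists (Hub true).
have unlK a b : adjacent N a b -> unl (l a) = a.
  move=> adj; have ain := mem_sites _ _ adj.
  have lt : index (l a) [seq l c | c <- sites N] < size (sites N).
    by rewrite -(size_map l) index_mem map_f.
  have [c adjc] := sites_adj _ (mem_nth Clasp lt).
  apply: (l_inj _ _ _ _ adjc adj); rewrite -(nth_map _ (l a)) // nth_index //.
  exact: map_f.
(* [unl] inverts [l] on the regions of the wheel. *)
pose e d := (unl (lab d), unl (lab (edge d))).
have e_ex a b : adjacent N a b -> exists2 d, e d = (a, b) & lab d = l a.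
  move=> adj; have [d [ea eb]] := links _ _ adj; exists d => //.
  by rewrite /e ea eb (unlK _ _ adj) (unlK b a) // adjacentC.
have e_ex' a b : adjacent N a b -> exists d, e d = (a, b).
  by move/e_ex => [d]; exists d.
have [e_inj e_adj] := arcs_count twist_card e_ex'.
have e_lab d : lab d = l (e d).1.
  by have [d' + <-] := e_ex _ _ (e_adj d); rewrite -surjective_pairing => /e_inj ->.
apply: (wheel_recognition N2 twist_card e_ex').
- by move=> d; rewrite /e edgeK.
move=> d d'; split=> [ed|/lettering dd'].
  by apply/lettering; rewrite !e_lab ed.
by rewrite /e /= dd'.
Qed.

End Reading.

Theorem theorem1p1 (P : fourvalent_map) (hP : nonsplit_projection P)
    (n : nat) (hn : 4 <= n) :
  same_projection P (twist_map n) <->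
  exists lab : P -> letter,
    region_lettering lab /\ axis_system_is lab (twist_words n).
Proof.
have tw := twist_wheel hn; have N1 : 1 < n.-1 by lia.
split=> [same|[lab [lettering system]]].
  have [e we] := wheel_same N1 same tw.
  exact: wheel_twist_words hn we.
have [e we] := twist_wheel_of_words hn lettering system.
exact: wheel_unique we tw.
Qed.
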